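(* Let $F,G\in\operatorname{dom}(L)$ be such that $FG\in\operatorname{dom}(L)$ as well. Then $\Gamma_0(F,G)\in L^1(\mathbb{P})$ is well-defined and, in fact, $\Gamma(F,G)=\Gamma_0(F,G)$.
   Context: Let $(E_n,\mathcal{B}_n,\mu_n)$, $n\in\mathbb{N}$, be probability spaces with product $(E,\mathcal{B},\mu)$. On a probability space $(\Omega,\mathcal{A},\mathbb{P})$ let $\mathbb{X}=(X_n)_{n\in\mathbb{N}}$ and $\mathbb{X}'=(X'_n)_{n\in\mathbb{N}}$ be two independent $E$-valued random sequences, each with distribution $\mu$. For $k\in\mathbb{N}$, $\mathbb{X}^{(k)}$ is obtained from $\mathbb{X}$ by replacing $X_k$ with $X_k'$. Let $\mathcal{F}=\sigma(\mathbb{X})$, $\mathcal{F}_n=\sigma(X_1,\dotsc,X_n)$, $\mathcal{G}_k=\sigma(X_j:j\neq k)$, $L^2_{\mathbb{X}}=L^2(\Omega,\mathcal{F},\mathbb{P})$. A representative of $F\in L^2_{\mathbb{X}}$ is $f\in L^2(\mu)$ with $F=f(\mathbb{X})$ a.s. $\kappa$ is counting measure on $\mathbb{N}$, $\mathbb{P}_{\mathcal F}$ the restriction of $\mathbb{P}$ to $\mathcal{F}$. Malliavin operators: $D_kF:=F-\mathbb{E}[F\mid\mathcal{G}_k]$. On the space of all $F\in L^2_{\mathbb{X}}$ that are $\mathcal{F}_n$-measurable for some $n$, put $DF:=(D_kF)_{k\in\mathbb{N}}\in L^2(\kappa\otimes\mathbb{P}_{\mathcal F})$; this is closable and its closure is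 denoted $D$ with domain $\operatorname{dom}(D)$. Let $\delta$ be the Hilbert space adjoint of $D$, and $\operatorname{dom}(L)=\{F\in\operatorname{dom}(D):DF\in\operatorname{dom}(\delta)\}$, $LF:=-\delta DF$. Carr\'e-du-champ operators: for $F,G\in\operatorname{dom}(L)$ with $FG\in\operatorname{dom}(L)$, $\Gamma(F,G):=\frac12\bigl(L(FG)-G\,LF-F\,LG\bigr)$. For $F,G\in\operatorname{dom}(D)$ with representatives $f,g$, $$\Gamma_0(F,G):=\frac12\sum_{k=1}^\infty\mathbb{E}\Bigl[\bigl(f(\mathbb{X}^{(k)})-f(\mathbb{X})\bigr)\bigl(g(\mathbb{X}^{(k)})-g(\mathbb{X})\bigr)\,\Big|\,\mathbb{X}\Bigr].$$ *)

(* Defs.v *)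
From HB Require Import structures.
From mathcomp Require Import all_boot all_order all_algebra.
From mathcomp Require Import all_classical all_reals all_analysis.

Set Implicit Arguments.
Unset Strict Implicit.
Unset Printing Implicit Defensive.

Import Order.TTheory GRing.Theory Num.Theory.
Import numFieldNormedType.Exports.

Local Open Scope classical_set_scope.
Local Open Scope ring_scope.

(* Elements of L^1 and L^2 are represented by functions; equalities between
   them are almost sure equalities.  Operators defined up to almost sure
   equality (conditional expectation, D, delta, L) are given by their graphs,
   and [xget] selects a version on the domain (and 0 outside of it).
   Sequences are indexed from 0. *)

(* The product sigma-algebra on sequences with n-th entry in E n. *)
Definition seq_space (dE : nat -> measure_display)
    (E : forall n, measurableType (dE n)) :=
  g_sigma_algebraType
    (\bigcup_n preimage_set_system setT
                 (fun x : forall n, E n => x n) measurable).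

(* The product measure is the unique probability measure with these values on
   finite-dimensional rectangles. *)
Definition is_product_probability (R : realType) (dE : nat -> measure_display)
    (E : forall n, measurableType (dE n)) (muE : forall n, probability (E n) R)
    (mu : probability (seq_space E) R) : Prop :=
  forall (n : nat) (A : forall i, set (E i)), (forall i, measurable (A i)) ->
    mu [set x | forall i, (i < n)%N -> A i (x i)] =
    (\prod_(i < n) muE i (A i))%E.

Section conditional_expectation.
Context d (T : measurableType d) (R : realType) (P : probability T R).

Definition has_distribution d' (S : measurableType d') (X : {RV P >-> S})
    (mu : probability S R) : Prop :=
  forall A, measurable A -> distribution P X A = mu A.

Definition independent_RV d1 d2 (S1 : measurableType d1)
    (S2 : measurableType d2) (X : {RV P >-> S1}) (Y : {RV P >-> S2}) : Prop :=
  forall A B, measurable A -> measurable B ->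
    P (X @^-1` A `&` Y @^-1` B) = (P (X @^-1` A) * P (Y @^-1` B))%E.

Definition measurable_wrt (G : set (set T)) (f : T -> R) : Prop :=
  forall B : set R, measurable B -> G (f @^-1` B).

Definition is_condexp (G : set (set T)) (F Z : T -> R) : Prop :=
  [/\ measurable_wrt G Z, Z \in Lfun P 1 &
      forall A, G A -> (\int[P]_(w in A) (Z w)%:E = \int[P]_(w in A) (F w)%:E)%E].

(* E[F | G] *)
Definition condexp (G : set (set T)) (F : T -> R) : T -> R :=
  xget (cst 0) [set Z | is_condexp G F Z].

End conditional_expectation.

Section malliavin.
Context d (T : measurableType d) (R : realType) (P : probability T R).
Context (dE : nat -> measure_display) (E : forall n, measurableType (dE n)).
Context (X : {RV P >-> seq_space E}).

(* sigma(X_j : j \in J) *)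
Definition sigma_coords (J : set nat) : set (set T) :=
  <<s \bigcup_(j in J) preimage_set_system setT
        (fun w => (X w : forall n, E n) j) measurable >>.

(* sigma(X) *)
Definition sigmaX : set (set T) := g_sigma_algebra_preimage X.

(* L^2(Omega, sigma(X), P) *)
Definition L2X (F : T -> R) : Prop := measurable_wrt sigmaX F /\ F \in Lfun P 2%:E.

Definition sqnorm (F : T -> R) : \bar R := (\int[P]_w (F w ^+ 2)%:E)%E.

(* An element of L^2(kappa (x) P_F) is written as the sequence of its sections
   at k : nat; the integral against the counting measure kappa is a series. *)
Definition seq_sqnorm (H : nat -> T -> R) : \bar R :=
  (\sum_(0 <= k <oo) sqnorm (H k))%E.

Definition seq_L2X (H : nat -> T -> R) : Prop :=
  (forall k, measurable_wrt sigmaX (H k)) /\ (seq_sqnorm H < +oo)%E.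

Definition seq_inner (H K : nat -> T -> R) : R :=
  \big[+%R/0]_(0 <= k <oo) \int[P]_w (H k w * K k w).

Definition Dk (k : nat) (F : T -> R) : T -> R :=
  F \- condexp P (sigma_coords [set j | j != k]) F.

Definition cylindrical (F : T -> R) : Prop :=
  L2X F /\ exists n, measurable_wrt (sigma_coords [set j | (j < n)%N]) F.

(* Closure in L^2_X x L^2(kappa (x) P_F) of the graph of F |-> (Dk F)_k on
   cylindrical F. *)
Definition D_graph (F : T -> R) (H : nat -> T -> R) : Prop :=
  [/\ L2X F, seq_L2X H &
      exists Fn : nat -> T -> R,
        [/\ forall n, cylindrical (Fn n),
            sqnorm (Fn n \- F) @[n --> \oo] --> 0%E &
            seq_sqnorm (fun k => Dk k (Fn n) \- H k) @[n --> \oo] --> 0%E]].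

Definition dom_D (F : T -> R) : Prop := exists H, D_graph F H.

Definition opD (F : T -> R) : nat -> T -> R :=
  xget (fun=> cst 0) [set H | D_graph F H].

Definition delta_graph (H : nat -> T -> R) (U : T -> R) : Prop :=
  [/\ seq_L2X H, L2X U &
      forall F, dom_D F -> seq_inner (opD F) H = \int[P]_w (F w * U w)].

Definition dom_delta (H : nat -> T -> R) : Prop := exists U, delta_graph H U.

Definition opdelta (H : nat -> T -> R) : T -> R :=
  xget (cst 0) [set U | delta_graph H U].

Definition dom_L (F : T -> R) : Prop := dom_D F /\ dom_delta (opD F).

Definition opL (F : T -> R) : T -> R := fun w => - opdelta (opD F) w.

Definition Gamma (F G : T -> R) : T -> R :=
  fun w => 2^-1 * (opL (F \* G) w - G w * opL F w - F w * opL G w).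

Definition representative (mu : probability (seq_space E) R)
    (F : T -> R) (f : seq_space E -> R) : Prop :=
  f \in Lfun mu 2%:E /\ F = f \o X %[ae P].

Context (X' : {RV P >-> seq_space E}).

(* X^(k) *)
Definition resample (k : nat) (w : T) : seq_space E :=
  fun n => if n == k then (X' w : forall n, E n) n else (X w : forall n, E n) n.

Definition Gamma0_increment (f g : seq_space E -> R) (k : nat) : T -> R :=
  fun w => (f (resample k w) - f (X w)) * (g (resample k w) - g (X w)).

Definition Gamma0_term (f g : seq_space E -> R) (k : nat) : T -> R :=
  condexp P sigmaX (Gamma0_increment f g k).

(* Gamma_0(F, G), for representatives f of F and g of G *)
Definition Gamma0 (f g : seq_space E -> R) : T -> R :=
  fun w => 2^-1 * \big[+%R/0]_(0 <= k <oo) Gamma0_term f g k w.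

End malliavin.

(* Main.v *)
Require Import Defs.
From HB Require Import structures.
From mathcomp Require Import all_boot all_order all_algebra.
From mathcomp Require Import all_classical all_reals all_analysis.
From mathcomp Require Import measurable_realfun ring lra.
Set Implicit Arguments.
Unset Strict Implicit.
Unset Printing Implicit Defensive.
Import Order.TTheory GRing.Theory Num.Theory.
Import numFieldNormedType.Exports.
Local Open Scope classical_set_scope.
Local Open Scope ring_scope.

(** Let [X^(k)] be [X] with coordinate [k] resampled, [F = f(X)], [G = g(X)],
   and [Delta_k f = f(X^(k)) - f(X)].

   Since [X^(k)] keeps all coordinates of [X] but the [k]-th one, and draws
   that one independently, [E[F | G_k] = E[f(X^(k)) | X]]: both are the average
   of [f] over its [k]-th argument (is_condexp_average).  Each [D_k] is
   moreover an orthogonal projection, so that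
   [E[D_k F * D_k G] = E[F G] - E[f(X^(k)) g(X)]] (Rintegral_DkM).  Two
   consequences carry the proof.

   First, [E[(Delta_k f)^2] = 2 E[(D_k F)^2]] (Rintegral_increment_sqr).  For
   [F] and [G] in the domain of [D] this makes the terms of [Gamma_0(F, G)]
   summable in L^1, hence almost surely (Gamma0_term_series, L1_series_cvg).

   Second, expanding [Delta_k f * Delta_k g] gives, for [H = h(X)] bounded,
   [E[H Delta_k f Delta_k g] =
      E[D_k(HG) D_k F] + E[D_k(HF) D_k G] - E[D_k H D_k(FG)]]
   (Rintegral_indicM_increment).  Let [H] be the indicator of an event that
   depends on finitely many coordinates.  Only finitely many [D_k] act on such
   an [H], so multiplication by [H] preserves the domain of [D]
   (dom_D_indicM).  Summing over [k], the duality between [D] and [delta] turns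
   the right-hand side into [E[H L(FG)] - E[HG LF] - E[HF LG]], which is
   [2 E[H Gamma(F, G)]], while the left-hand side sums to
   [2 E[H Gamma_0(F, G)]].

   Events that depend on finitely many coordinates generate [sigma(X)] and are
   stable under intersection, so the two functions have the same integral over
   every event of [sigma(X)] (integral_cylinder_eq0).  Both are measurable with
   respect to [sigma(X)], hence they agree almost surely. *)

(** * Integrable and square-integrable functions *)

Section L1_L2.
Context d (T : measurableType d) (R : realType) (P : probability T R).
Implicit Types (F G : T -> R) (A : set T).

Lemma Lfun_measurable p F : F \in Lfun P p -> measurable_fun setT F.
Proof. by rewrite inE => /andP[/[!inE]]. Qed.

Lemma L1_lin a F G : F \in Lfun P 1 -> G \in Lfun P 1 ->
  (fun w => a * F w + G w) \in Lfun P 1.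
Proof. exact: (Lfun_submod_closed P (lexx (1%:E : \bar R))).2. Qed.

Lemma L2_lin a F G : F \in Lfun P 2%:E -> G \in Lfun P 2%:E ->
  (fun w => a * F w + G w) \in Lfun P 2%:E.
Proof. exact: (Lfun_submod_closed P (lee1n 2 : (1 <= 2%:E)%E)).2. Qed.

Lemma L1_D F G : F \in Lfun P 1 -> G \in Lfun P 1 ->
  (fun w => F w + G w) \in Lfun P 1.
Proof.
by move=> f g; have := L1_lin 1 f g; under eq_fun do rewrite mul1r.
Qed.

Lemma L1_B F G : F \in Lfun P 1 -> G \in Lfun P 1 ->
  (fun w => F w - G w) \in Lfun P 1.
Proof.
by move=> f g; have := L1_lin (-1) g f; under eq_fun do rewrite mulN1r addrC.
Qed.

Lemma L2_B F G : F \in Lfun P 2%:E -> G \in Lfun P 2%:E ->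
  (fun w => F w - G w) \in Lfun P 2%:E.
Proof.
by move=> f g; have := L2_lin (-1) g f; under eq_fun do rewrite mulN1r addrC.
Qed.

Lemma L1_Z a F : F \in Lfun P 1 -> (fun w => a * F w) \in Lfun P 1.
Proof.
move=> f; have : (cst 0 : T -> R) \in Lfun P 1 by exact: Lfun_cst.
by move=> /(L1_lin a f); under eq_fun do rewrite addr0.
Qed.

Lemma L2_L1 F : F \in Lfun P 2%:E -> F \in Lfun P 1.
Proof. by apply: Lfun_subset12; exact: fin_num_measure. Qed.

Lemma L2_M F G : F \in Lfun P 2%:E -> G \in Lfun P 2%:E ->
  (fun w => F w * G w) \in Lfun P 1.
Proof. exact: Lfun2_mul_Lfun1. Qed.

Lemma L1_norm F : F \in Lfun P 1 -> (fun w => `|F w|) \in Lfun P 1.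
Proof. exact: Lfun_norm. Qed.

Lemma L1P F : F \in Lfun P 1 <->
  measurable_fun setT F /\ (\int[P]_w `|(F w)%:E| < +oo)%E.
Proof.
rewrite Lfun1_integrable; split => [/integrableP[/measurable_EFinP]//|[mF h]].
by apply/integrableP; split => //; exact/measurable_EFinP.
Qed.

Lemma L2P F : F \in Lfun P 2%:E <->
  measurable_fun setT F /\ (sqnorm P F < +oo)%E.
Proof.
have e : (\int[P]_w ((`|F w| `^ 2)%:E) = sqnorm P F)%E.
  by apply: eq_integral => w _; rewrite powR_mulrn// real_normK// num_real.
split=> [F2|[mF sF]].
  split; first exact: Lfun_measurable F2.
  have /integrableP[_] := Lfun2_integrable_sqr F2.
  apply: le_lt_trans; apply: ge0_le_integral => //.
  - by move=> w _; rewrite lee_fin sqr_ge0.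
  - apply/measurable_EFinP/measurable_funX; exact: Lfun_measurable F2.
  - apply: measurableT_comp => //.
    apply/measurable_EFinP/measurable_funX; exact: Lfun_measurable F2.
  - by move=> w _; rewrite /= lee_fin ler_norm.
rewrite inE; apply/andP; split; rewrite inE//=.
by rewrite /finite_norm unlock poweR_lty//= e.
Qed.

Lemma L2_sqr F :
  F \in Lfun P 2%:E <->
  measurable_fun setT F /\ (fun w => F w ^+ 2) \in Lfun P 1.
Proof.
rewrite L2P L1P; split=> -[mF]; last move=> [_]; rewrite /sqnorm => h; split=> //.
- split; first exact: measurable_funX.
  by under eq_integral do rewrite gee0_abs ?lee_fin ?sqr_ge0//.
- by move: h; under eq_integral do rewrite gee0_abs ?lee_fin ?sqr_ge0//.
Qed.

Lemma sqnorm_Rintegral F : F \in Lfun P 2%:E ->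
  sqnorm P F = (\int[P]_w (F w * F w))%:E.
Proof.
move=> F2; rewrite /Rintegral fineK.
  by apply: eq_integral => w _; rewrite expr2.
apply: integrable_fin_num => //; have := L2_M F2 F2.
by rewrite Lfun1_integrable.
Qed.

Lemma sqnorm_ge0 F : (0 <= sqnorm P F)%E.
Proof. by apply: integral_ge0 => w _; rewrite lee_fin sqr_ge0. Qed.

Lemma L1_le F G : measurable_fun setT F -> G \in Lfun P 1 ->
  (forall w, `|F w| <= `|G w|) -> F \in Lfun P 1.
Proof.
move=> mF /Lfun1_integrable G1 FG; apply/Lfun1_integrable.
apply: le_integrable G1 => //; first exact/measurable_EFinP.
by move=> w _; rewrite /= lee_fin.
Qed.

Lemma L2_le F G : measurable_fun setT F -> G \in Lfun P 2%:E ->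
  (forall w, `|F w| <= `|G w|) -> F \in Lfun P 2%:E.
Proof.
move=> mF /L2P[mG sG] FG; apply/L2P; split => //.
apply: le_lt_trans sG; apply: ge0_le_integral => //.
- by move=> w _; rewrite lee_fin sqr_ge0.
- exact/measurable_EFinP/measurable_funX.
- exact/measurable_EFinP/measurable_funX.
- move=> w _; rewrite lee_fin -[F w ^+ 2]real_normK ?num_real//.
  by rewrite -[G w ^+ 2]real_normK ?num_real// lerXn2r ?nnegrE.
Qed.

Lemma measurable_indicM A F : measurable A -> measurable_fun setT F ->
  measurable_fun setT (fun w => \1_A w * F w).
Proof.
by move=> mA mF; apply: measurable_funM => //; exact: measurable_indic.
Qed.

Lemma normr_indicM A F w : `|\1_A w * F w| <= `|F w|.
Proof.
by rewrite indicE; case: (w \in A); rewrite ?mul1r// mul0r normr0.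
Qed.

Lemma L1_indicM A F : measurable A -> F \in Lfun P 1 ->
  (fun w => \1_A w * F w) \in Lfun P 1.
Proof.
move=> mA F1; apply: (L1_le _ F1) => [|w]; last exact: normr_indicM.
by apply: measurable_indicM => //; exact: Lfun_measurable F1.
Qed.

Lemma L2_indicM A F : measurable A -> F \in Lfun P 2%:E ->
  (fun w => \1_A w * F w) \in Lfun P 2%:E.
Proof.
move=> mA F1; apply: (L2_le _ F1) => [|w]; last exact: normr_indicM.
by apply: measurable_indicM => //; exact: Lfun_measurable F1.
Qed.

Lemma L2_indic A : measurable A -> (\1_A : T -> R) \in Lfun P 2%:E.
Proof.
move=> mA; have := L2_indicM mA (Lfun_cst P 1 2).
by under eq_fun do rewrite mulr1.
Qed.

Lemma L1_RintegralB F G : F \in Lfun P 1 -> G \in Lfun P 1 ->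
  \int[P]_w (F w - G w) = \int[P]_w F w - \int[P]_w G w.
Proof. by move=> /Lfun1_integrable ? /Lfun1_integrable ?; rewrite RintegralB. Qed.

Lemma L1_RintegralD F G : F \in Lfun P 1 -> G \in Lfun P 1 ->
  \int[P]_w (F w + G w) = \int[P]_w F w + \int[P]_w G w.
Proof. by move=> /Lfun1_integrable ? /Lfun1_integrable ?; rewrite RintegralD. Qed.

Lemma L1_RintegralZ a F : F \in Lfun P 1 ->
  \int[P]_w (a * F w) = a * \int[P]_w F w.
Proof. by move=> /Lfun1_integrable ?; rewrite RintegralZl. Qed.

Lemma Rintegral_probability_cst c : \int[P]_w c = c.
Proof.
rewrite Rintegral_cst// (_ : fine _ = 1) ?mulr1//.
have PT : P setT = 1%E by exact: probability_setT.
by rewrite -[RHS]/(fine 1%E) -PT.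
Qed.

Lemma L1_le_Rintegral F G : F \in Lfun P 1 -> G \in Lfun P 1 ->
  (forall w, F w <= G w) -> \int[P]_w F w <= \int[P]_w G w.
Proof.
by move=> /Lfun1_integrable ? /Lfun1_integrable ? h; exact: le_Rintegral.
Qed.

Lemma ae_eq_Rintegral F G : measurable_fun setT F -> measurable_fun setT G ->
  F = G %[ae P] -> \int[P]_w F w = \int[P]_w G w.
Proof.
move=> mF mG FG; congr fine; apply: ae_eq_integral => //.
- exact/measurable_EFinP.
- exact/measurable_EFinP.
- by apply: filterS FG => w /= /[apply] ->.
Qed.

Lemma sqnorm_ae F G : measurable_fun setT F -> measurable_fun setT G ->
  F = G %[ae P] -> sqnorm P F = sqnorm P G.
Proof.
move=> mF mG FG; apply: ae_eq_integral => //.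
- exact/measurable_EFinP/measurable_funX.
- exact/measurable_EFinP/measurable_funX.
- by apply: filterS FG => w /= /[apply] ->.
Qed.

Lemma L2_ae F G : measurable_fun setT G -> F = G %[ae P] ->
  F \in Lfun P 2%:E -> G \in Lfun P 2%:E.
Proof.
move=> mG FG /L2P[mF F2]; apply/L2P; split => //.
by rewrite -(sqnorm_ae mF mG FG).
Qed.

Lemma integral_indicM A F : measurable A -> F \in Lfun P 1 ->
  (\int[P]_(w in A) (F w)%:E = (\int[P]_w (\1_A w * F w))%:E)%E.
Proof.
move=> mA F1; rewrite /Rintegral fineK; last first.
  apply: integrable_fin_num => //; have := L1_indicM mA F1.
  by rewrite Lfun1_integrable.
rewrite [LHS]integral_mkcond; apply: eq_integral => w _.
by rewrite patchE indicE; case: ifP; rewrite ?mul1r ?mul0r.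
Qed.

Lemma ge0_Rintegral_eq0 F : F \in Lfun P 1 -> (forall w, 0 <= F w) ->
  \int[P]_w F w = 0 -> F = cst 0 %[ae P].
Proof.
move=> F1 F0 EF0.
have mF : measurable_fun setT (EFin \o F).
  exact/measurable_EFinP/(Lfun_measurable F1).
have /(ae_eq_integral_abs P measurableT mF) : (\int[P]_w `|(EFin \o F) w| = 0)%E.
  under eq_integral do rewrite /= ger0_norm//.
  have /Lfun1_integrable/(integrable_fin_num measurableT)/fineK <- := F1.
  by rewrite [fine _]EF0.
by apply: filterS => w /= h /h [].
Qed.

Lemma sqnorm0_ae F : F \in Lfun P 2%:E -> sqnorm P F = 0%E ->
  F = cst 0 %[ae P].
Proof.
move=> F2; rewrite (sqnorm_Rintegral F2) => -[].
move/(ge0_Rintegral_eq0 (L2_M F2 F2)) => h.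
have {}h := h (fun w => sqr_ge0 (F w)).
apply: filterS h => w /= h /h /eqP; rewrite mulf_eq0 => /orP[]/eqP //.
Qed.

(** Young's inequality instead of Cauchy-Schwarz: it is enough wherever only
   the finiteness of a sum of products is at stake. *)
Lemma Rintegral_mul_le F G : F \in Lfun P 2%:E -> G \in Lfun P 2%:E ->
  \int[P]_w `|F w * G w| <=
  2^-1 * (\int[P]_w (F w * F w) + \int[P]_w (G w * G w)).
Proof.
move=> F2 G2; have FF := L2_M F2 F2; have GG := L2_M G2 G2.
rewrite -L1_RintegralD// -L1_RintegralZ; last exact: L1_D.
apply: L1_le_Rintegral; [exact/L1_norm/L2_M|exact/L1_Z/L1_D|move=> w].
rewrite normrM.
have := sqr_ge0 (`|F w| - `|G w|).
have := real_normK (num_real (F w)); have := real_normK (num_real (G w)).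
rewrite !expr2; nra.
Qed.

End L1_L2.

(** * Pointwise limits *)

Section pointwise_limit.
Context d (T : measurableType d) (R : realType).

(** Upper and lower limits are measurable functions without any assumption of
   convergence, so this makes the set of convergence measurable. *)
Lemma cvgn_limn_einf_esup (u : nat -> R) :
  cvgn u <-> limn_einf (EFin \o u) = limn_esup (EFin \o u) /\
             limn_esup (EFin \o u) \is a fin_num.
Proof.
split=> [/cvg_ex[l ul]|[e f]].
  have /cvg_limn_einf_sup[-> ->] : (EFin \o u) n @[n --> \oo] --> l%:E.
    by apply: cvg_EFin; [exact: nearW|exact: ul].
  by [].
have : (EFin \o u) n @[n --> \oo] --> limn_esup (EFin \o u).
  apply: (@squeeze_cvge _ _ _ _ (einfs (EFin \o u)) _ (esups (EFin \o u))).
  - apply: nearW => n; apply/andP; split.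
    + by apply: ereal_inf_lbound; exists n => /=.
    + by apply: ereal_sup_ubound; exists n => /=.
  - by rewrite -e limn_einf_lim; exact: is_cvg_einfs.
  - by rewrite limn_esup_lim; exact: is_cvg_esups.
rewrite -(fineK f) => /fine_cvgP[_ h].
by apply/cvg_ex; exists (fine (limn_esup (EFin \o u))).
Qed.

Lemma measurable_cvgn (u : nat -> T -> R) :
  (forall n, measurable_fun setT (u n)) ->
  measurable [set w | cvgn (u ^~ w)].
Proof.
move=> mu; set v := fun n w => (u n w)%:E.
have mv n : measurable_fun setT (v n) by exact/measurable_EFinP.
have ms : measurable_fun setT (fun w => limn_esup (v ^~ w)).
  exact: measurable_fun_limn_esup.
have mi : measurable_fun setT (fun w => limn_einf (v ^~ w)).
  apply: (@measurableT_comp _ _ _ _ _ _ -%E) => //.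
  by apply: measurable_fun_limn_esup => n; exact: measurableT_comp.
rewrite [X in measurable X](_ : _ =
    (setT `&` [set w | limn_einf (v ^~ w) = limn_esup (v ^~ w)]) `&`
    (setT `&` [set w | limn_esup (v ^~ w) \is a fin_num])); last first.
  apply/seteqP; split=> w /=.
    by move/cvgn_limn_einf_esup => [].
  by move=> [[_ e] [_ f]]; apply/cvgn_limn_einf_esup.
apply: measurableI; [exact: measurable_eqe|exact: emeasurable_fin_num].
Qed.

(** Off the set of convergence, [limn] takes its default value [0]. *)
Lemma measurable_fun_limn (u : nat -> T -> R) :
  (forall n, measurable_fun setT (u n)) ->
  measurable_fun setT (fun w => limn (u ^~ w)).
Proof.
move=> mu; set C := [set w | cvgn (u ^~ w)].
have mC : measurable C by exact: measurable_cvgn.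
apply: (@measurable_fun_cvg _ _ _ _ (fun n w => \1_C w * u n w)) => [n|w _].
  by apply: measurable_funM => //; exact: measurable_indic.
have [Cw|nCw] := pselect (C w).
  under eq_fun do rewrite indicE mem_set// mul1r.
  exact: Cw.
under eq_fun do rewrite indicE memNset// mul0r.
rewrite (_ : limn (u ^~ w) = 0); first exact: cvg_cst.
by apply: dvgP.
Qed.

End pointwise_limit.

(** * Conditional expectations *)

Section sub_sigma_algebra.
Context d (T : measurableType d) (R : realType) (P : probability T R).
Context (G : set (set T)) (sG : sigma_algebra setT G).
Hypothesis GT : G `<=` @measurable d T.
Implicit Types (F H Z : T -> R) (A : set T).

(** Turns [measurable_wrt] into measurability on a type carrying [G] as its
   sigma-algebra, so that the closure properties of measurable functions
   apply. *)
Lemma measurable_wrtP F :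
  measurable_wrt G F <-> measurable_fun setT (F : g_sigma_algebraType G -> R).
Proof.
have mG : @measurable _ (g_sigma_algebraType G) = G by exact: sigma_algebra_id.
split=> [mF _ B mB|mF B mB]; first by rewrite setTI mG; exact: mF.
by have := mF measurableT B mB; rewrite setTI mG.
Qed.

Lemma measurable_wrt_measurable F : measurable_wrt G F -> measurable_fun setT F.
Proof. by move=> mF _ B mB; rewrite setTI; exact/GT/mF. Qed.

Lemma measurable_wrt_cst c : measurable_wrt G (cst c : T -> R).
Proof. by apply/measurable_wrtP; exact: measurable_cst. Qed.

Lemma measurable_wrtD F H : measurable_wrt G F -> measurable_wrt G H ->
  measurable_wrt G (fun w => F w + H w).
Proof.
move=> /measurable_wrtP f /measurable_wrtP h; apply/measurable_wrtP.
exact: measurable_funD.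
Qed.

Lemma measurable_wrtB F H : measurable_wrt G F -> measurable_wrt G H ->
  measurable_wrt G (fun w => F w - H w).
Proof.
move=> /measurable_wrtP f /measurable_wrtP h; apply/measurable_wrtP.
exact: measurable_funB.
Qed.

Lemma measurable_wrtM F H : measurable_wrt G F -> measurable_wrt G H ->
  measurable_wrt G (fun w => F w * H w).
Proof.
move=> /measurable_wrtP f /measurable_wrtP h; apply/measurable_wrtP.
exact: measurable_funM.
Qed.

Lemma measurable_wrtZ a F : measurable_wrt G F ->
  measurable_wrt G (fun w => a * F w).
Proof. by move=> f; apply: measurable_wrtM => //; exact: measurable_wrt_cst. Qed.

Lemma measurable_wrt_indic A : G A -> measurable_wrt G (\1_A : T -> R).
Proof.
move=> GA; apply/measurable_wrtP; apply: measurable_indic.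
by rewrite /measurable/= sigma_algebra_id.
Qed.

Lemma measurable_wrt_limn (u : nat -> T -> R) :
  (forall n, measurable_wrt G (u n)) ->
  measurable_wrt G (fun w => limn (u ^~ w)).
Proof.
move=> mu; apply/measurable_wrtP.
apply: (@measurable_fun_limn _ (g_sigma_algebraType G) R u) => n.
exact/measurable_wrtP.
Qed.

Lemma measurable_wrt_sum (u : nat -> T -> R) n :
  (forall k, measurable_wrt G (u k)) ->
  measurable_wrt G (fun w => \sum_(0 <= k < n) u k w).
Proof.
move=> mu; elim: n => [|n IHn].
  by under eq_fun do rewrite big_geq//; exact: measurable_wrt_cst.
by under eq_fun do rewrite big_nat_recr//=; exact: measurable_wrtD.
Qed.

Lemma measurable_wrt_lt F H : measurable_wrt G F -> measurable_wrt G H ->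
  G [set w | F w < H w].
Proof.
move=> mF mH.
have := measurable_wrtB mF mH (measurable_itv `]-oo, 0[).
by congr G; apply/seteqP; split=> w /=; rewrite in_itv/= subr_lt0.
Qed.

Lemma is_condexpP F Z : F \in Lfun P 1 ->
  is_condexp P G F Z <->
  [/\ measurable_wrt G Z, Z \in Lfun P 1 &
      forall A, G A -> \int[P]_w (\1_A w * Z w) = \int[P]_w (\1_A w * F w)].
Proof.
move=> F1; split=> -[mZ Z1 h]; split => // A GA; have mA := GT GA.
- by have := h _ GA; rewrite !integral_indicM// => -[].
- by rewrite !integral_indicM// h.
Qed.

Let condexp_le F Z Z' : F \in Lfun P 1 ->
  is_condexp P G F Z -> is_condexp P G F Z' ->
  {ae P, forall w, Z w <= Z' w}.
Proof.
move=> F1 /(is_condexpP _ F1)[mZ Z1 EZ_] /(is_condexpP _ F1)[mZ' Z'1 EZ'].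
set A := [set w | Z' w < Z w].
have GA : G A by exact: measurable_wrt_lt.
have mA := GT GA.
have : (fun w => \1_A w * Z w - \1_A w * Z' w) = cst 0 %[ae P].
  apply: ge0_Rintegral_eq0 => [|w|].
  - by apply: L1_B; exact: L1_indicM.
  - rewrite indicE; case: (boolP (w \in A)); rewrite ?mul0r ?subrr// inE.
    by move=> Aw; rewrite !mul1r subr_ge0; exact: ltW.
  - by rewrite L1_RintegralB ?EZ_ ?EZ' ?subrr//; exact: L1_indicM.
apply: filterS => w /(_ I); rewrite indicE leNgt => h; apply/negP => Aw.
move: h; rewrite mem_set// !mul1r => /eqP; rewrite /cst subr_eq0 => /eqP e.
by move: Aw; rewrite e ltxx.
Qed.

(** Two versions integrate alike over the event that one exceeds the other. *)
Lemma condexp_unique F Z Z' : F \in Lfun P 1 ->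
  is_condexp P G F Z -> is_condexp P G F Z' -> Z = Z' %[ae P].
Proof.
move=> F1 c c'.
have h1 := condexp_le F1 c c'; have h2 := condexp_le F1 c' c.
by apply: filterS2 h1 h2 => w a b _; apply/eqP; rewrite eq_le a b.
Qed.

Lemma is_condexp_condexp F Z : is_condexp P G F Z ->
  is_condexp P G F (condexp P G F).
Proof. by move=> c; apply: (xgetPex (cst 0)); exists Z. Qed.

Lemma condexp_ae F Z : F \in Lfun P 1 -> is_condexp P G F Z ->
  condexp P G F = Z %[ae P].
Proof.
move=> F1 c; have c' := is_condexp_condexp c; exact: (condexp_unique F1 c' c).
Qed.

Lemma is_condexpB F F' Z Z' : F \in Lfun P 1 -> F' \in Lfun P 1 ->
  is_condexp P G F Z -> is_condexp P G F' Z' ->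
  is_condexp P G (fun w => F w - F' w) (fun w => Z w - Z' w).
Proof.
move=> F1 F'1 /(is_condexpP _ F1)[mZ Z1 h] /(is_condexpP _ F'1)[mZ' Z'1 h'].
apply/is_condexpP; first exact: L1_B.
split=> [||A GA]; [exact: measurable_wrtB|exact: L1_B|].
have mA := GT GA.
under eq_Rintegral do rewrite mulrBr.
under [RHS]eq_Rintegral do rewrite mulrBr.
by rewrite !L1_RintegralB ?h ?h'//; exact: L1_indicM.
Qed.

(** Pulling out a known factor: for an indicator, this amounts to testing the
   original conditional expectation on smaller sets. *)
Lemma is_condexp_indicM A F Z : G A -> F \in Lfun P 1 ->
  is_condexp P G F Z ->
  is_condexp P G (fun w => \1_A w * F w) (fun w => \1_A w * Z w).
Proof.
move=> GA F1 /(is_condexpP _ F1)[mZ Z1 h]; have mA := GT GA.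
apply/is_condexpP; first exact: L1_indicM.
split=> [||B GB]; [|exact: L1_indicM|].
  by apply: measurable_wrtM => //; exact: measurable_wrt_indic.
have e w : \1_B w * \1_A w = \1_(B `&` A) w :> R by rewrite indicI.
under eq_Rintegral do rewrite mulrA e.
under [RHS]eq_Rintegral do rewrite mulrA e.
apply: h; have := @measurableI _ (g_sigma_algebraType G) B A.
by rewrite /measurable/= sigma_algebra_id//; exact.
Qed.

Lemma is_condexp_aeW F F' Z : F \in Lfun P 1 -> F' \in Lfun P 1 ->
  F = F' %[ae P] -> is_condexp P G F Z -> is_condexp P G F' Z.
Proof.
move=> F1 F'1 FF' /(is_condexpP _ F1)[mZ Z1 h]; apply/is_condexpP => //.
split=> // A GA; rewrite h//; have mA := GT GA; apply: ae_eq_Rintegral.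
- exact/(measurable_indicM mA)/(Lfun_measurable F1).
- exact/(measurable_indicM mA)/(Lfun_measurable F'1).
- by apply: filterS FF' => w h' /h' ->.
Qed.

(** Test against the sign of the conditional expectation. *)
Lemma is_condexp_norm_le F Z : F \in Lfun P 1 -> is_condexp P G F Z ->
  \int[P]_w `|Z w| <= \int[P]_w `|F w|.
Proof.
move=> F1 /(is_condexpP _ F1)[mZ Z1 h].
set A := [set w | cst 0 w < Z w]; set B := [set w | Z w < cst 0 w].
have GA : G A by apply: measurable_wrt_lt => //; exact: measurable_wrt_cst.
have GB : G B by apply: measurable_wrt_lt => //; exact: measurable_wrt_cst.
have mA := GT GA; have mB := GT GB.
have -> : \int[P]_w `|Z w| = \int[P]_w (\1_A w * F w - \1_B w * F w).
  rewrite L1_RintegralB -?h// -?L1_RintegralB; try exact: L1_indicM.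
  apply: eq_Rintegral => w _; rewrite !indicE.
  case: (ltgtP 0 (Z w)) => Zw.
  - have nB : ~ B w by rewrite /B/= => /(lt_trans Zw); rewrite ltxx.
    by rewrite (mem_set (Zw : A w)) (memNset nB) mul1r mul0r subr0 gtr0_norm.
  - have nA : ~ A w by rewrite /A/= => /(lt_trans Zw); rewrite ltxx.
    by rewrite (mem_set (Zw : B w)) (memNset nA) mul1r mul0r sub0r ltr0_norm.
  - by rewrite -Zw !mulr0 subrr normr0.
apply: L1_le_Rintegral => [||w];
  [by apply: L1_B; exact: L1_indicM|exact: L1_norm|].
rewrite !indicE; case: (boolP (w \in A)) => [/set_mem Aw|_].
  have nB : ~ B w by rewrite /B/= => /(lt_trans Aw); rewrite ltxx.
  by rewrite (memNset nB) mul1r mul0r subr0 ler_norm.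
rewrite mul0r sub0r; case: (w \in B); last by rewrite mul0r oppr0.
by rewrite mul1r -normrN ler_norm.
Qed.

End sub_sigma_algebra.

(** * Change of variables *)

Section change_of_variables.
Context d (T : measurableType d) (R : realType) (P : probability T R).
Context d' (S : measurableType d') (nu : {measure set S -> \bar R}).
Context (Y : {RV P >-> S}).
Hypothesis hY : forall A, measurable A -> distribution P Y A = nu A.
Implicit Types f : S -> R.

Let mY : measurable_fun setT Y. Proof. exact: measurable_funP. Qed.

Lemma law_ge0_integral (f : S -> \bar R) : measurable_fun setT f ->
  (forall x, 0 <= f x)%E -> (\int[nu]_x f x = \int[P]_w f (Y w))%E.
Proof.
move=> mf f0; rewrite -(ge0_integral_distribution Y)//.
by apply: eq_measure_integral => A mA _; rewrite -hY.
Qed.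

Lemma law_L1 f : measurable_fun setT f ->
  f \in Lfun nu 1 <-> (fun w => f (Y w)) \in Lfun P 1.
Proof.
move=> mf; rewrite !Lfun1_integrable.
have e : (\int[nu]_x `|(f x)%:E| = \int[P]_w `|(f (Y w))%:E|)%E.
  apply: (law_ge0_integral (f := fun x => `|(f x)%:E|%E)) => //.
  by apply: measurableT_comp => //; exact/measurable_EFinP.
split=> /integrableP[_ h]; apply/integrableP; split.
- exact/measurable_EFinP/measurableT_comp.
- by rewrite -e.
- exact/measurable_EFinP.
- by rewrite [ltLHS]e.
Qed.

Lemma law_Rintegral f : measurable_fun setT f ->
  (fun w => f (Y w)) \in Lfun P 1 ->
  \int[nu]_x f x = \int[P]_w f (Y w).
Proof.
move=> mf /Lfun1_integrable f1; congr fine.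
rewrite -(@integral_distribution _ _ _ _ _ P Y (EFin \o f))//; last first.
  exact/measurable_EFinP.
by apply: eq_measure_integral => A mA _; rewrite -hY.
Qed.

End change_of_variables.

Lemma law_L2 d (T : measurableType d) (R : realType) (P : probability T R)
    d' (S : measurableType d') (nu : probability S R) (Y : {RV P >-> S})
    (hY : has_distribution Y nu) (f : S -> R) : measurable_fun setT f ->
  f \in Lfun nu 2%:E <-> (fun w => f (Y w)) \in Lfun P 2%:E.
Proof.
move=> mf; rewrite !L2_sqr.
have mY : measurable_fun setT Y by exact: measurable_funP.
have := law_L1 hY (measurable_funX 2 mf).
move=> [h1 h2]; split=> -[_ h].
  by split; [exact: measurableT_comp|exact: h1].
by split; [|exact: h2].
Qed.

(** * Independent copies *)

(** For independent [X], [X'] with the same law [mu], integrating out the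
   second argument against [mu] is a version of the conditional expectation
   given [X].  This explicit version is what gives access to the conditional
   expectations with respect to all the sigma-algebras involved. *)
Section independent_copies.
Context d (T : measurableType d) (R : realType) (P : probability T R).
Context d' (S : measurableType d') (mu : probability S R).
Context (X X' : {RV P >-> S}).
Hypotheses (hX : has_distribution X mu) (hX' : has_distribution X' mu).
Hypothesis hXX' : independent_RV X X'.
Implicit Types (h : S * S -> R) (u : S -> R).

Let mX : measurable_fun setT X. Proof. exact: measurable_funP. Qed.
Let mX' : measurable_fun setT X'. Proof. exact: measurable_funP. Qed.

Let Y w := (X w, X' w).
Let mY : measurable_fun setT Y. Proof. exact: measurable_fun_pair. Qed.
HB.instance Definition _ := isMeasurableFun.Build _ _ _ _ Y mY.

Let hY A : measurable A -> distribution P (Y : {RV P >-> _}) A = (mu \x mu)%E A.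
Proof.
move=> mA; apply/esym.
apply: (@product_measure_unique _ _ _ _ _ mu mu
  (distribution P (Y : {RV P >-> _}))) => //.
move=> B C mB mC; transitivity (mu B * mu C)%E => //.
by rewrite -(hX mB) -(hX' mC) -hXX'.
Qed.

Definition integrate_snd h (x : S) : R := \int[mu]_y h (x, y).

Lemma integrable_prod h : measurable_fun setT h ->
  (fun w => h (X w, X' w)) \in Lfun P 1 ->
  (mu \x mu)%E.-integrable setT (EFin \o h).
Proof. by move=> mh h1; rewrite -Lfun1_integrable; apply/(law_L1 hY mh). Qed.

Lemma measurable_integrate_snd h : measurable_fun setT h ->
  (fun w => h (X w, X' w)) \in Lfun P 1 ->
  measurable_fun setT (integrate_snd h).
Proof.
move=> mh h1; have /measurable_fubini_F := integrable_prod mh h1.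
by move=> mf; exact: measurableT_comp.
Qed.

Lemma integrate_snd_L1 h : measurable_fun setT h ->
  (fun w => h (X w, X' w)) \in Lfun P 1 ->
  (fun w => integrate_snd h (X w)) \in Lfun P 1.
Proof.
move=> mh h1; apply/(law_L1 hX); first exact: measurable_integrate_snd.
have /integrable_fubini_F := integrable_prod mh h1.
move=> /[dup] /(measurable_int mu) mF /integrableP[_ Fi].
apply/L1P; split; first exact: measurable_integrate_snd.
apply: le_lt_trans Fi; apply: ge0_le_integral => //.
- apply: measurableT_comp => //; apply/measurable_EFinP.
  exact: measurable_integrate_snd.
- exact: measurableT_comp.
- move=> x _; rewrite /fubini_F /integrate_snd /Rintegral/=.
  by case: (\int[mu]_y _)%E => [r||]; rewrite //= normr0 leey.
Qed.

Lemma Rintegral_integrate_snd h : measurable_fun setT h ->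
  (fun w => h (X w, X' w)) \in Lfun P 1 ->
  \int[P]_w integrate_snd h (X w) = \int[P]_w h (X w, X' w).
Proof.
move=> mh h1; have hi := integrable_prod mh h1.
rewrite -(law_Rintegral hX (measurable_integrate_snd mh h1)
  (integrate_snd_L1 mh h1)).
rewrite -(law_Rintegral hY mh h1) /Rintegral; congr fine.
rewrite -integral12_prod_meas1//; apply: ae_eq_integral => //.
- exact/measurable_EFinP/measurable_integrate_snd.
- exact: measurable_fubini_F hi.
- have := ae_integrable1 hi; apply: filterS => x hx _.
  by rewrite /integrate_snd /Rintegral fineK//; exact: integrable_fin_num.
Qed.

Lemma integrate_sndM h u : measurable_fun setT h -> measurable_fun setT u ->
  (fun w => h (X w, X' w)) \in Lfun P 1 ->
  (fun w => u (X w) * h (X w, X' w)) \in Lfun P 1 ->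
  (fun w => integrate_snd (fun z => u z.1 * h z) (X w)) =
  (fun w => u (X w) * integrate_snd h (X w)) %[ae P].
Proof.
move=> mh mu_ h1 uh1; have := ae_integrable1 (integrable_prod mh h1).
move=> [N [mN N0 sN]]; exists (X @^-1` N); split.
- by rewrite -[X in measurable X]setTI; exact: mX.
- exact: etrans (hX mN) N0.
- move=> w nw; apply: contrapT => nN; apply: nw => _.
  apply: (L1_RintegralZ (P := mu) (u (X w)) (F := fun y => h (X w, y))).
  by apply/Lfun1_integrable; apply: contrapT => ?; apply: nN; exact: sN.
Qed.

(** Fubini's theorem for the joint law [mu \x mu] of [X] and [X'], the weight
   [u(X)] being constant in the inner integral. *)
Lemma Rintegral_mul_integrate_snd h u :
  measurable_fun setT h -> measurable_fun setT u ->
  (fun w => h (X w, X' w)) \in Lfun P 1 ->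
  (fun w => u (X w) * h (X w, X' w)) \in Lfun P 1 ->
  \int[P]_w (u (X w) * integrate_snd h (X w)) =
  \int[P]_w (u (X w) * h (X w, X' w)).
Proof.
move=> mh mu_ h1 uh1.
have muh : measurable_fun setT (fun z : S * S => u z.1 * h z).
  by apply: measurable_funM => //; exact: measurableT_comp.
rewrite -(Rintegral_integrate_snd muh uh1); apply: ae_eq_Rintegral.
- apply: measurable_funM; first exact: measurableT_comp.
  by apply: measurableT_comp mX; exact: measurable_integrate_snd.
- by apply: measurableT_comp mX; exact: measurable_integrate_snd.
- by apply: ae_eq_sym; exact: integrate_sndM.
Qed.

(** Jensen's inequality, in the form of the nonnegativity of a variance. *)
Lemma integrate_snd_L2 h : measurable_fun setT h ->
  (fun w => h (X w, X' w)) \in Lfun P 2%:E ->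
  (fun w => integrate_snd h (X w)) \in Lfun P 2%:E.
Proof.
move=> mh h2; have h1 := L2_L1 h2.
have mq : measurable_fun setT (integrate_snd h).
  exact: measurable_integrate_snd.
apply/(law_L2 hX mq)/L2_sqr; split => //.
have mh2 : measurable_fun setT (fun z => h z ^+ 2) by exact: measurable_funX.
have hh1 : (fun w => h (X w, X' w) ^+ 2) \in Lfun P 1 by case/L2_sqr : h2.
have := integrate_snd_L1 mh2 hh1.
rewrite -(law_L1 hX (measurable_integrate_snd mh2 hh1)) => q1.
apply/L1P; split; first exact: measurable_funX.
have /L1P[_] := q1; apply: le_lt_trans; apply: ae_ge0_le_integral => //.
- by apply: measurableT_comp => //; apply/measurable_EFinP/measurable_funX.
- apply: measurableT_comp => //; apply/measurable_EFinP.
  exact: measurable_integrate_snd.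
- have := ae_integrable1 (integrable_prod mh2 hh1).
  apply: filterS => x hx _.
  have hx2 : (fun y => h (x, y)) \in Lfun mu 2%:E.
    apply/L2_sqr; split; last by rewrite Lfun1_integrable.
    by apply: measurableT_comp => //; exact: measurable_fun_pair.
  rewrite !abse_EFin lee_fin ger0_norm ?sqr_ge0// (le_trans _ (ler_norm _))//.
  have cst2 : cst (integrate_snd h x) \in Lfun mu 2%:E by exact: Lfun_cst.
  (* the variance of h (x, .), expanded *)
  have := L2_B hx2 cst2 => /L2_sqr [_ b1].
  have : 0 <= \int[mu]_y ((h (x, y) - integrate_snd h x) ^+ 2).
    by apply: Rintegral_ge0 => y _; exact: sqr_ge0.
  have e y : (h (x, y) - integrate_snd h x) ^+ 2 =
      h (x, y) ^+ 2 - (2 * integrate_snd h x) * h (x, y) + integrate_snd h x ^+ 2.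
    by ring.
  under eq_Rintegral do rewrite e.
  have /L2_sqr[_ hx22] := hx2.
  have c1 : (cst (integrate_snd h x ^+ 2) : S -> R) \in Lfun mu 1.
    exact: Lfun_cst.
  rewrite L1_RintegralD//; last by apply: L1_B => //; exact/L1_Z/L2_L1.
  rewrite L1_RintegralB//; last exact/L1_Z/L2_L1.
  rewrite L1_RintegralZ; last exact: L2_L1.
  rewrite Rintegral_probability_cst.
  rewrite -/(integrate_snd h x) -/(integrate_snd (fun z => h z ^+ 2) x).
  by nra.
Qed.

Lemma is_condexp_integrate_snd h : measurable_fun setT h ->
  (fun w => h (X w, X' w)) \in Lfun P 1 ->
  is_condexp P (g_sigma_algebra_preimage X) (fun w => h (X w, X' w))
    (fun w => integrate_snd h (X w)).
Proof.
move=> mh h1; have mq := measurable_integrate_snd mh h1.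
split=> [B mB||A [B mB <-]]; [|exact: integrate_snd_L1|].
  exists (integrate_snd h @^-1` B); last by rewrite setTI.
  by rewrite -[X in measurable X]setTI; exact: mq.
have mXB : measurable (X @^-1` B) by rewrite -[X in measurable X]setTI; exact: mX.
rewrite setTI !integral_indicM//; last exact: integrate_snd_L1.
congr EFin; apply: (Rintegral_mul_integrate_snd (u := \1_B)) => //.
exact: (L1_indicM mXB h1).
Qed.

End independent_copies.

(** * Product spaces and resampling *)

Section product_space.
Context (dE : nat -> measure_display) (E : forall n, measurableType (dE n)).
Local Notation S := (seq_space E).

Definition cylinder n (A : forall i, set (E i)) : set S :=
  [set x | forall i, (i < n)%N -> A i (x i)].

Definition cylinders : set (set S) :=
  [set B | exists n A, (forall i, measurable (A i)) /\ B = cylinder n A].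

Lemma measurable_coord n : measurable_fun setT (fun x : S => x n).
Proof.
move=> _ B mB; rewrite setTI; apply: sub_sigma_algebra.
by exists n => //; exists B => //; rewrite setTI.
Qed.

Lemma measurable_to_seq_space d (T : measurableType d) (phi : T -> S) :
  (forall n, measurable_fun setT (fun w => (phi w : forall n, E n) n)) ->
  measurable_fun setT phi.
Proof.
move=> mphi; apply: (@measurability _ _ T S setT phi
  (\bigcup_n preimage_set_system setT (fun x : forall n, E n => x n) measurable)).
  by [].
move=> _ [_ [n _ [B mB <-]] <-]; rewrite setTI.
exact: (mphi n measurableT B mB).
Qed.

Lemma cylinder_bigcap n A :
  cylinder n A =
  \bigcap_(i in [set i | (i < n)%N]) ((fun x : S => x i) @^-1` A i).
Proof. by apply/seteqP; split=> x. Qed.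

Lemma measurable_cylinder n A : (forall i, measurable (A i)) ->
  measurable (cylinder n A).
Proof.
move=> mA; rewrite cylinder_bigcap; apply: bigcap_measurableType => i _.
by rewrite -[X in measurable X]setTI; exact: measurable_coord.
Qed.

Lemma cylinders_setI : setI_closed cylinders.
Proof.
move=> _ _ [n [A [mA ->]]] [m [B [mB ->]]].
exists (maxn n m), (fun i => (if (i < n)%N then A i else setT) `&`
  (if (i < m)%N then B i else setT)); split=> [i|].
  by apply: measurableI; case: ifP.
apply/seteqP; split=> x.
  by move=> [xA xB] i _; split; case: ifP => // h; [exact: xA|exact: xB].
move=> h; split=> i ilt.
  by have [] := h i (leq_trans ilt (leq_maxl _ _)); rewrite ilt.
by have [] := h i (leq_trans ilt (leq_maxr _ _)); rewrite ilt.
Qed.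

(** The cast along [n = i] is forced by the dependency of the factors on the
   index. *)
Lemma coord_cylinder n (B : set (E n)) : measurable B ->
  cylinders [set x | B (x n)].
Proof.
move=> mB.
exists n.+1, (fun i => if pselect (n = i) is left e
  then eq_rect n (fun j => set (E j)) B i e else setT); split=> [i|].
  by case: pselect => // e; case: i / e.
apply/seteqP; split=> x /=.
  by move=> Bx i _; case: pselect => // e; case: i / e.
move=> /(_ n (ltnSn n)); case: pselect => // e.
by rewrite (Prop_irrelevance e erefl).
Qed.

Lemma measurable_cylinders : @measurable _ S = <<s cylinders >>.
Proof.
apply/seteqP; split.
  apply: smallest_sub; first exact: smallest_sigma_algebra.
  move=> _ [n _ [B mB <-]]; rewrite setTI; apply: sub_sigma_algebra.
  exact: coord_cylinder.
apply: smallest_sub; first exact: sigma_algebra_measurable.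
by move=> _ [n [A [mA ->]]]; exact: measurable_cylinder.
Qed.

(** Resampling on the level of values: [resample X X' k w] is
   [replace k (X w, X' w)]. *)
Definition replace k (z : S * S) : S :=
  fun n => if n == k then (z.2 : forall n, E n) n else (z.1 : forall n, E n) n.

Lemma measurable_replace k : measurable_fun setT (replace k).
Proof.
apply: measurable_to_seq_space => n; rewrite /replace; case: (n == k).
  exact: (measurableT_comp (@measurable_coord n) measurable_snd).
exact: (measurableT_comp (@measurable_coord n) measurable_fst).
Qed.

Lemma replace_replace k x y y' :
  replace k (replace k (x, y), y') = replace k (x, y').
Proof.
apply: (@functional_extensionality_dep nat (fun n => E n)) => n.
by rewrite /replace/=; case: (n == k).
Qed.

Context (R : realType) (muE : forall n, probability (E n) R).

Lemma product_probability_unique (mu nu : probability S R) :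
  is_product_probability muE mu -> is_product_probability muE nu ->
  forall B, measurable B -> mu B = nu B.
Proof.
move=> hmu hnu B; rewrite measurable_cylinders => mB.
have muT : (mu : set S -> _) setT = nu setT.
  by rewrite (_ : _ setT = 1%E) ?probability_setT//; exact: probability_setT.
move: B mB; apply: (dynkin_induction measurable_cylinders cylinders_setI).
- exact: muT.
- by move=> _ [n [A [mA ->]]]; rewrite hmu// hnu.
- move=> C mC muC; have -> : mu (~` C) = (1 - mu C)%E by exact: probability_setC.
  have -> : nu (~` C) = (1 - nu C)%E by exact: probability_setC.
  by rewrite muC.
- move=> F mF tF muF.
  have mUF : measurable (\bigcup_n F n) by exact: bigcup_measurable.
  have -> : mu (\bigcup_k F k) = (\sum_(0 <= k <oo) mu (F k))%E.
    exact: measure_semi_bigcup.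
  have -> : nu (\bigcup_k F k) = (\sum_(0 <= k <oo) nu (F k))%E.
    exact: measure_semi_bigcup.
  by apply: eq_eseriesr => k _; exact: muF.
Qed.

End product_space.
Arguments replace {dE E}.
Arguments cylinder {dE E}.

(** * Factorization through a random variable *)

Section factorization.
Context d (T : measurableType d) (R : realType).
Context d' (S : measurableType d') (X : T -> S).

(** Doob-Dynkin.  If [F < q] is the event [X \in B q] for each rational [q],
   then the function [x |-> inf {q | x \in B q}] composed with [X] is [F]. *)
Lemma factorization (F : T -> R) :
  measurable_wrt (g_sigma_algebra_preimage X) F ->
  exists2 f : S -> R, measurable_fun setT f & F = f \o X.
Proof.
move=> mF.
have /choice[B hB] (q : rat) : exists B : set S,
    measurable B /\ X @^-1` B = [set w | F w < ratr q].
  have [B mB XB] := mF `]-oo, (ratr q : R)[%classic (measurable_itv _).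
  exists B; split=> //; rewrite -[LHS]setTI XB.
  by apply/seteqP; split=> w /=; rewrite in_itv.
pose g x := ereal_inf [set (ratr q : R)%:E | q in [set q | B q x]].
have mg : measurable_fun setT g.
  apply: (measurability _ (ErealGenCInfty.measurableE R)) => //.
  move=> _ [_ [r ->] <-]; rewrite setTI.
  rewrite (_ : _ @^-1` _ =
      ~` \bigcup_(q : rat) (if ratr q < r then B q else set0)).
    apply: measurableC; apply: bigcupT_measurable_rat => q.
    by case: ifP => // _; case: (hB q).
  apply/seteqP; split=> x /=; rewrite in_itv/= andbT.
    move=> rg [q _]; case: ifP => // qr Bqx; move: rg; apply/negP; rewrite -ltNge.
    apply: (@le_lt_trans _ _ (ratr q)%:E) => //.
    by apply: ereal_inf_lbound; exists q.
  move=> h; apply: le_ereal_inf_tmp => _ [q Bqx <-]; rewrite lee_fin leNgt.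
  by apply/negP => qr; apply: h; exists q => //; rewrite qr.
exists (fine \o g); first exact: measurableT_comp.
apply/funext => w; rewrite /= (_ : g (X w) = (F w)%:E)//.
have BX q : B q (X w) <-> F w < ratr q.
  have [_ e] := hB q; split=> [Bq|Fq].
    by have : (X @^-1` B q) w by []; rewrite e.
  by have : [set w | F w < ratr q] w by []; rewrite -e.
apply/eqP; rewrite eq_le; apply/andP; split; last first.
  by apply: le_ereal_inf_tmp => _ [q /BX Fq <-]; rewrite lee_fin ltW.
apply/lee_addgt0Pr => e e0.
have [q /andP[Fq qe]] : exists q : rat, F w < ratr q < F w + e.
  by have [q] := @rat_in_itvoo R (F w) (F w + e) (ltr_pwDr e0 (lexx _));
    rewrite in_itv/= => ?; exists q.
apply: (@le_trans _ _ (ratr q)%:E); last by rewrite -EFinD lee_fin ltW.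
by apply: ereal_inf_lbound; exists q => //; exact/BX.
Qed.

End factorization.

(** * Resampling one coordinate *)

Section resampling.
Context d (T : measurableType d) (R : realType) (P : probability T R).
Context (dE : nat -> measure_display) (E : forall n, measurableType (dE n)).
Context (muE : forall n, probability (E n) R) (mu : probability (seq_space E) R).
Hypothesis hmu : is_product_probability muE mu.
Context (X X' : {RV P >-> seq_space E}).
Hypotheses (hX : has_distribution X mu) (hX' : has_distribution X' mu).
Hypothesis hXX' : independent_RV X X'.
Local Notation S := (seq_space E).
Implicit Types (f g : S -> R) (F : T -> R).

Let mX : measurable_fun setT X. Proof. exact: measurable_funP. Qed.
Let mX' : measurable_fun setT X'. Proof. exact: measurable_funP. Qed.

Let measurable_preimage B : measurable B -> measurable (X @^-1` B).
Proof. by move=> mB; rewrite -[X in measurable X]setTI; exact: mX. Qed.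

Lemma measurable_resample k : measurable_fun setT (resample X X' k).
Proof.
rewrite (_ : resample X X' k = replace k \o (fun w => (X w, X' w)))//.
apply: (measurableT_comp (measurable_replace k)).
exact: (measurable_fun_pair mX mX').
Qed.

HB.instance Definition _ k :=
  isMeasurableFun.Build _ _ _ _ (resample X X' k) (measurable_resample k).

(** The event that [X^(k)] lies in a cylinder splits into an event on [X] that
   leaves coordinate [k] free and an event on [X'] that only constrains
   coordinate [k]. *)
Lemma law_resample k :
  has_distribution (resample X X' k : {RV P >-> S}) mu.
Proof.
move=> B mB.
apply: (product_probability_unique
  (mu := distribution P (resample X X' k : {RV P >-> S})) _ hmu mB) => n A mA.
pose A1 (i : nat) : set (E i) := if i == k then setT else A i.
pose A2 (i : nat) : set (E i) := if i == k then A i else setT.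
have mA1 i : measurable (A1 i) by rewrite /A1; case: ifP.
have mA2 i : measurable (A2 i) by rewrite /A2; case: ifP.
have m1 := measurable_cylinder n mA1; have m2 := measurable_cylinder n mA2.
transitivity (P (X @^-1` cylinder n A1 `&` X' @^-1` cylinder n A2)).
  congr (P _); apply/seteqP; split=> w.
    move=> h; split=> i ilt;
      have : A i (if i == k then (X' w : forall n, E n) i
                            else (X w : forall n, E n) i) := h i ilt;
      by rewrite /A1 /A2; case: (i == k).
  move=> [h1 h2] i ilt; have := h1 i ilt; have := h2 i ilt.
  rewrite /A1 /A2 => a2 a1.
  suff : A i (if i == k then (X' w : forall n, E n) i
                        else (X w : forall n, E n) i) by [].
  by move: a1 a2; case: (i == k).
transitivity (mu (cylinder n A1) * mu (cylinder n A2))%E.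
  by rewrite hXX'// -(hX m1) -(hX' m2).
have -> : mu (cylinder n A1) = (\prod_(i < n) muE i (A1 i))%E := hmu n mA1.
have -> : mu (cylinder n A2) = (\prod_(i < n) muE i (A2 i))%E := hmu n mA2.
rewrite -big_split/=.
apply: eq_bigr => i _; rewrite /A1 /A2; case: (nat_of_ord i == k).
  by rewrite (_ : muE i setT = 1%E) ?mul1e//; exact: probability_setT.
by rewrite (_ : muE i setT = 1%E) ?mule1//; exact: probability_setT.
Qed.

Lemma resample_L1 k f : measurable_fun setT f ->
  (fun w => f (X w)) \in Lfun P 1 ->
  (fun w => f (resample X X' k w)) \in Lfun P 1.
Proof.
move=> mf /(law_L1 hX mf) f1.
exact/(law_L1 (Y := resample X X' k : {RV P >-> S}) (@law_resample k) mf).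
Qed.

Lemma resample_L2 k f : measurable_fun setT f ->
  (fun w => f (X w)) \in Lfun P 2%:E ->
  (fun w => f (resample X X' k w)) \in Lfun P 2%:E.
Proof.
move=> mf /(law_L2 hX mf) f1.
exact/(law_L2 (Y := resample X X' k : {RV P >-> S}) (@law_resample k) mf).
Qed.

Lemma Rintegral_resample k f : measurable_fun setT f ->
  (fun w => f (X w)) \in Lfun P 1 ->
  \int[P]_w f (resample X X' k w) = \int[P]_w f (X w).
Proof.
move=> mf f1; rewrite -(law_Rintegral hX mf f1).
rewrite (law_Rintegral (Y := resample X X' k : {RV P >-> S}) (@law_resample k))//.
exact: resample_L1.
Qed.

(** ** Sigma-algebras of coordinates *)

Lemma sigma_algebra_sigmaX : sigma_algebra setT (sigmaX X).
Proof. by apply: sigma_algebra_preimage; exact: sigma_algebra_measurable. Qed.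

Lemma sigmaX_measurable : sigmaX X `<=` measurable.
Proof. by move=> _ [B mB <-]; exact: mX. Qed.

Lemma sigma_algebra_coords J : sigma_algebra setT (sigma_coords X J).
Proof. exact: smallest_sigma_algebra. Qed.

Lemma sigma_coords_sub J J' : J `<=` J' ->
  sigma_coords X J `<=` sigma_coords X J'.
Proof.
move=> JJ'; apply: sub_sigma_algebra2 => A [j Jj Aj].
by exists j => //; exact: JJ'.
Qed.

Lemma sigma_coords_sigmaX J : sigma_coords X J `<=` sigmaX X.
Proof.
apply: smallest_sub; first exact: sigma_algebra_sigmaX.
move=> _ [j _ [B mB <-]].
exists [set x : S | B ((x : forall n, E n) j)] => //.
by have := @measurable_coord _ E j measurableT B mB; rewrite setTI.
Qed.

Lemma sigma_coords_measurable J : sigma_coords X J `<=` measurable.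
Proof. by move=> A /sigma_coords_sigmaX /sigmaX_measurable. Qed.

Lemma sigma_coords_cylinder n (A : forall i, set (E i)) :
  (forall i, measurable (A i)) ->
  sigma_coords X [set j | (j < n)%N] (X @^-1` cylinder n A).
Proof.
move=> mA; rewrite cylinder_bigcap preimage_bigcap.
apply: (@bigcap_measurableType _ (g_sigma_algebraType
  (\bigcup_(j in [set j | (j < n)%N]) preimage_set_system setT
        (fun w => (X w : forall n, E n) j) measurable))) => i ilt.
apply: sub_sigma_algebra; exists i => //; exists (A i) => //.
by rewrite setTI.
Qed.

(** Membership in an event of the sigma-algebra of all coordinates but [k] is
   insensitive to the replacement of coordinate [k]; this is a property of the
   generators that countable set operations preserve. *)
Lemma sigma_coords_invariant k A : sigma_coords X [set j | j != k] A ->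
  exists B, [/\ measurable B, A = X @^-1` B &
    forall x y, B (replace k (x, y)) <-> B x].
Proof.
pose H := [set A | exists B : set S, [/\ measurable B, A = X @^-1` B &
    forall x y, B (replace k (x, y)) <-> B x]].
suff : sigma_coords X [set j | j != k] `<=` H by exact.
apply: smallest_sub => [|_ [j jk [B mB <-]]]; last first.
  exists [set x : S | B ((x : forall n, E n) j)]; split.
  - by have := @measurable_coord _ E j measurableT B mB; rewrite setTI.
  - by rewrite setTI.
  - by move=> x y; rewrite /replace/= (negbTE jk).
split.
- by exists set0; split => //; rewrite preimage_set0.
- move=> _ [B [mB -> iB]]; exists (~` B); split; first exact: measurableC.
    by rewrite setTD preimage_setC.
  by move=> x y; split=> nB h; apply: nB; [exact/iB|exact/(iB _ y)].
- move=> F /choice[B hB]; exists (\bigcup_n B n); split.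
  + by apply: bigcup_measurable => n _; case: (hB n).
  + by rewrite preimage_bigcup; apply: eq_bigcupr => n _; case: (hB n).
  + by move=> x y; split=> -[n _ h]; exists n => //; have [_ _ i] := hB n;
      [exact/(i _ y)|exact/i].
Qed.

(** ** Conditional expectation given all coordinates but one *)

(** The integral of [f] over its [k]-th argument; [average k f (X)] is a
   version of [E[f(X^(k)) | X]]. *)
Definition average k f : S -> R := integrate_snd mu (fun z => f (replace k z)).

Lemma average_replace k f x y : average k f (replace k (x, y)) = average k f x.
Proof.
by apply: eq_Rintegral => y' _; rewrite replace_replace.
Qed.

Let mreplace k f : measurable_fun setT f ->
  measurable_fun setT (fun z => f (replace k z)).
Proof. by move=> mf; exact: measurableT_comp (measurable_replace k). Qed.

Lemma measurable_average k f : measurable_fun setT f ->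
  (fun w => f (X w)) \in Lfun P 1 -> measurable_fun setT (average k f).
Proof.
move=> mf f1; apply: (measurable_integrate_snd hX hX' hXX' (mreplace k mf)).
exact: resample_L1.
Qed.

Lemma average_L1 k f : measurable_fun setT f ->
  (fun w => f (X w)) \in Lfun P 1 ->
  (fun w => average k f (X w)) \in Lfun P 1.
Proof.
move=> mf f1; apply: (integrate_snd_L1 hX hX' hXX' (mreplace k mf)).
exact: resample_L1.
Qed.

Lemma average_L2 k f : measurable_fun setT f ->
  (fun w => f (X w)) \in Lfun P 2%:E ->
  (fun w => average k f (X w)) \in Lfun P 2%:E.
Proof.
move=> mf f1; apply: (integrate_snd_L2 hX hX' hXX' (mreplace k mf)).
exact: resample_L2.
Qed.

Lemma Rintegral_mul_average k f g :
  measurable_fun setT f -> measurable_fun setT g ->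
  (fun w => f (X w)) \in Lfun P 2%:E -> (fun w => g (X w)) \in Lfun P 2%:E ->
  \int[P]_w (g (X w) * average k f (X w)) =
  \int[P]_w (g (X w) * f (resample X X' k w)).
Proof.
move=> mf mg f2 g2.
apply: (Rintegral_mul_integrate_snd hX hX' hXX' (mreplace k mf) mg).
  by apply: resample_L1 => //; exact: L2_L1.
by apply: L2_M => //; exact: resample_L2.
Qed.

(** A function [g] that ignores coordinate [k] takes the same value at [X] and
   at [X^(k)], so that both factors can be evaluated at [X^(k)], which has the
   law of [X]. *)
Lemma Rintegral_mul_average_invariant k f g : measurable_fun setT f ->
  measurable_fun setT g ->
  (forall x y, g (replace k (x, y)) = g x) ->
  (fun w => f (X w)) \in Lfun P 1 -> (fun w => g (X w) * f (X w)) \in Lfun P 1 ->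
  \int[P]_w (g (X w) * average k f (X w)) = \int[P]_w (g (X w) * f (X w)).
Proof.
move=> mf mg ig f1 gf1.
have mgf : measurable_fun setT (fun x => g x * f x) by exact: measurable_funM.
have e w : g (X w) * f (resample X X' k w) =
    g (resample X X' k w) * f (resample X X' k w).
  by congr (_ * _); rewrite -(ig (X w) (X' w)).
rewrite -(Rintegral_resample k mgf gf1).
under [RHS]eq_Rintegral do rewrite -e.
apply: (Rintegral_mul_integrate_snd hX hX' hXX' (mreplace k mf) mg).
  exact: resample_L1.
by have := resample_L1 k mgf gf1; under eq_fun do rewrite -e.
Qed.

(** Conditioning on all coordinates but [k] amounts to resampling coordinate
   [k] and conditioning on [X]. *)
Lemma is_condexp_average k f : measurable_fun setT f ->
  (fun w => f (X w)) \in Lfun P 1 ->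
  is_condexp P (sigma_coords X [set j | j != k]) (fun w => f (X w))
    (fun w => average k f (X w)).
Proof.
move=> mf f1; have ma := measurable_average k mf f1.
split=> [B mB||A /sigma_coords_invariant[B [mB -> iB]]].
- (* freezing coordinate k exhibits the average as a function of the others *)
  pose s w := replace k (X w, (point : S)).
  have ms : @measurable_fun _ _ (g_sigma_algebraType
      (\bigcup_(j in [set j | j != k]) preimage_set_system setT
        (fun w => (X w : forall n, E n) j) measurable)) S setT s.
    apply: measurable_to_seq_space => n; rewrite /s /replace/=.
    case: (eqVneq n k) => nk; first exact: measurable_cst.
    by move=> _ C mC; apply: sub_sigma_algebra; exists n => //; exists C.
  have := ms measurableT _ (ma measurableT B mB); rewrite !setTI.
  congr (sigma_coords _ _ _); apply/seteqP; split=> w /=;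
    by rewrite /s average_replace.
- exact: average_L1.
- have mXB := measurable_preimage mB.
  rewrite !integral_indicM//; last exact: average_L1.
  congr EFin; apply: (Rintegral_mul_average_invariant (g := \1_B)) => //.
  + move=> x y; rewrite !indicE; congr (_%:R); congr nat_of_bool.
    by apply/idP/idP; rewrite !inE => /iB.
  + exact: (L1_indicM mXB f1).
Qed.

End resampling.

(** * The difference operators *)

Section difference_operators.
Context d (T : measurableType d) (R : realType) (P : probability T R).
Context (dE : nat -> measure_display) (E : forall n, measurableType (dE n)).
Context (muE : forall n, probability (E n) R) (mu : probability (seq_space E) R).
Hypothesis hmu : is_product_probability muE mu.
Context (X X' : {RV P >-> seq_space E}).
Hypotheses (hX : has_distribution X mu) (hX' : has_distribution X' mu).
Hypothesis hXX' : independent_RV X X'.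
Local Notation S := (seq_space E).
Local Notation others k := (sigma_coords X [set j | j != k]).
Implicit Types (f g : S -> R) (F G : T -> R) (k n : nat).

Lemma L2X_representative F : L2X X F -> exists f, representative X mu F f.
Proof.
move=> [mF F2]; have [f mf Ff] := factorization mF.
exists f; split; last by apply: aeW => w _; rewrite Ff.
by apply/(law_L2 hX mf); move: F2; rewrite Ff.
Qed.

Lemma representative_measurable F f :
  representative X mu F f -> measurable_fun setT f.
Proof. by move=> [/Lfun_measurable]. Qed.

Lemma representative_L2 F f : representative X mu F f ->
  (fun w => f (X w)) \in Lfun P 2%:E.
Proof. by move=> [f2 _]; apply/(law_L2 hX) => //; exact: Lfun_measurable f2. Qed.

Lemma L2X_L2 F : L2X X F -> F \in Lfun P 2%:E. Proof. by case. Qed.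

Lemma L2X_B F G : L2X X F -> L2X X G -> L2X X (fun w => F w - G w).
Proof.
move=> [mF F2] [mG G2]; split; last exact: L2_B.
exact: (measurable_wrtB (sigma_algebra_sigmaX X)).
Qed.

Lemma L2X_indicM (A : set T) F : sigmaX X A -> L2X X F ->
  L2X X (fun w => \1_A w * F w).
Proof.
have sX := sigma_algebra_sigmaX X.
move=> sA [mF F2]; split.
  by apply: (measurable_wrtM sX) => //; exact: (measurable_wrt_indic sX).
by apply: L2_indicM F2; exact: sigmaX_measurable sA.
Qed.

Lemma L2X_cst c : L2X X (cst c).
Proof.
split; last exact: Lfun_cst.
exact: (measurable_wrt_cst (sigma_algebra_sigmaX X)).
Qed.

Let others_sub k : others k `<=` @measurable d T.
Proof. exact: sigma_coords_measurable. Qed.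

Lemma is_condexp_representative k F f : F \in Lfun P 2%:E ->
  representative X mu F f ->
  is_condexp P (others k) F (fun w => average mu k f (X w)).
Proof.
move=> F2 Ff; have mf := representative_measurable Ff.
have f2 := representative_L2 Ff.
apply: (is_condexp_aeW (@others_sub k) (L2_L1 f2) (L2_L1 F2)).
  by apply: ae_eq_sym; case: Ff.
by apply: (is_condexp_average hmu hX hX' hXX') => //; exact: L2_L1.
Qed.

Lemma is_condexp_others k F : L2X X F ->
  is_condexp P (others k) F (condexp P (others k) F).
Proof.
move=> FX; have [f Ff] := L2X_representative FX.
exact: is_condexp_condexp (is_condexp_representative k (L2X_L2 FX) Ff).
Qed.

Lemma Dk_representative k F f : L2X X F -> representative X mu F f ->
  Dk X k F = (fun w => f (X w) - average mu k f (X w)) %[ae P].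
Proof.
move=> FX Ff.
have c := is_condexp_representative k (L2X_L2 FX) Ff.
have := condexp_ae (sigma_algebra_coords X _) (@others_sub k)
  (L2_L1 (L2X_L2 FX)) c.
case: Ff => _ FfX; apply: filterS2 FfX => w e1 e2 _.
by rewrite /Dk/= e1// e2.
Qed.

Lemma L2X_Dk k F : L2X X F -> L2X X (Dk X k F).
Proof.
move=> FX; have [f Ff] := L2X_representative FX.
have [mC _ _] := is_condexp_others k FX.
have mD : measurable_wrt (sigmaX X) (Dk X k F).
  apply: (measurable_wrtB (sigma_algebra_sigmaX X)); first by case: FX.
  by move=> B /mC; exact: sigma_coords_sigmaX.
split => //; have := Dk_representative k FX Ff => /ae_eq_sym e.
apply: (L2_ae _ e).
  exact: (measurable_wrt_measurable (@sigmaX_measurable _ _ _ _ _ _ X)).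
have mf := representative_measurable Ff; have f2 := representative_L2 Ff.
by apply: L2_B => //; exact: (average_L2 hmu hX hX' hXX').
Qed.

Lemma measurable_Dk k F : L2X X F -> measurable_fun setT (Dk X k F).
Proof. by move=> /(L2X_Dk k)/L2X_L2/Lfun_measurable. Qed.

Lemma DkB k F G : L2X X F -> L2X X G ->
  Dk X k (fun w => F w - G w) = (fun w => Dk X k F w - Dk X k G w) %[ae P].
Proof.
move=> FX GX; have F1 := L2_L1 (L2X_L2 FX); have G1 := L2_L1 (L2X_L2 GX).
have sG := sigma_algebra_coords X [set j | j != k].
have c := is_condexpB sG (@others_sub k) F1 G1
  (is_condexp_others k FX) (is_condexp_others k GX).
have := condexp_ae sG (@others_sub k) (L1_B F1 G1) c.
by apply: filterS => w e _; rewrite /Dk/= e//; ring.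
Qed.

(** As [n <= k], the event [A] belongs to the sigma-algebra of all coordinates
   but [k]. *)
Lemma Dk_indicM k n (A : set T) F : (n <= k)%N ->
  sigma_coords X [set j | (j < n)%N] A -> L2X X F ->
  Dk X k (fun w => \1_A w * F w) = (fun w => \1_A w * Dk X k F w) %[ae P].
Proof.
move=> nk sA FX; have F1 := L2_L1 (L2X_L2 FX).
have sG := sigma_algebra_coords X [set j | j != k].
have oA : others k A.
  by apply: sigma_coords_sub sA => j /= jn; rewrite ltn_eqF// (leq_trans jn).
have c := is_condexp_indicM sG (@others_sub k) oA F1 (is_condexp_others k FX).
have := condexp_ae sG (@others_sub k) (L1_indicM (others_sub oA) F1) c.
by apply: filterS => w e _; rewrite /Dk/= e//; ring.
Qed.

Lemma Dk_cst k c : Dk X k (cst c) = cst 0 %[ae P].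
Proof.
have c1 : (cst c : T -> R) \in Lfun P 1 by exact: Lfun_cst.
have sG := sigma_algebra_coords X [set j | j != k].
have : is_condexp P (others k) (cst c) (cst c).
  by split => //; exact: measurable_wrt_cst.
move=> /(condexp_ae sG (@others_sub k) c1).
by apply: filterS => w e _; rewrite /Dk/= e// subrr.
Qed.

Lemma Rintegral_averageM k f g : measurable_fun setT f -> measurable_fun setT g ->
  (fun w => f (X w)) \in Lfun P 2%:E -> (fun w => g (X w)) \in Lfun P 2%:E ->
  \int[P]_w (average mu k g (X w) * average mu k f (X w)) =
  \int[P]_w (average mu k g (X w) * f (X w)).
Proof.
move=> mf mg f2 g2; have ag := average_L2 hmu hX hX' hXX' k mg g2.
apply: (Rintegral_mul_average_invariant hmu hX hX' hXX') => //.
- by apply: (measurable_average hmu hX hX' hXX') => //; exact: L2_L1.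
- by move=> x y; exact: average_replace.
- exact: L2_L1.
- exact: L2_M.
Qed.

(** [D_k] is an orthogonal projection, so that the left-hand side is
   [E[F G] - E[E[F | G_k] G]]; and [E[F | G_k] = E[f(X^(k)) | X]]. *)
Lemma Rintegral_DkM k F G f g : L2X X F -> L2X X G ->
  representative X mu F f -> representative X mu G g ->
  \int[P]_w (Dk X k F w * Dk X k G w) =
  \int[P]_w (f (X w) * g (X w)) - \int[P]_w (g (X w) * f (resample X X' k w)).
Proof.
move=> FX GX Ff Gg.
have mf := representative_measurable Ff; have mg := representative_measurable Gg.
have f2 := representative_L2 Ff; have g2 := representative_L2 Gg.
have af := average_L2 hmu hX hX' hXX' k mf f2.
have ag := average_L2 hmu hX hX' hXX' k mg g2.
transitivity (\int[P]_w ((f (X w) - average mu k f (X w)) *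
                         (g (X w) - average mu k g (X w)))).
  apply: ae_eq_Rintegral.
  - by apply: measurable_funM; exact: measurable_Dk.
  - apply: (Lfun_measurable (P := P) (p := 1%E)).
    by apply: L2_M; exact: L2_B.
  - apply: filterS2 (Dk_representative k FX Ff) (Dk_representative k GX Gg).
    by move=> w e1 e2 _; rewrite e1// e2.
under eq_Rintegral => w _.
  rewrite (_ : _ * _ = f (X w) * g (X w) - g (X w) * average mu k f (X w)
    - (average mu k g (X w) * f (X w)
       - average mu k g (X w) * average mu k f (X w))); last by ring.
  over.
rewrite L1_RintegralB; [|by apply: L1_B; exact: L2_M..].
rewrite [X in _ - X]L1_RintegralB; [|exact: L2_M..].
rewrite Rintegral_averageM// subrr subr0 L1_RintegralB; [|exact: L2_M..].
by rewrite (Rintegral_mul_average hmu hX hX' hXX').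
Qed.

Lemma sqnorm_Dk_le k F : L2X X F -> (sqnorm P (Dk X k F) <= sqnorm P F)%E.
Proof.
move=> FX; have [f Ff] := L2X_representative FX.
have mf := representative_measurable Ff; have f2 := representative_L2 Ff.
have af := average_L2 hmu hX hX' hXX' k mf f2.
rewrite (sqnorm_Rintegral (L2X_L2 (L2X_Dk k FX))) (Rintegral_DkM k FX FX Ff Ff).
have -> : sqnorm P F = sqnorm P (fun w => f (X w)).
  apply: sqnorm_ae; last by case: Ff.
    exact: Lfun_measurable (L2X_L2 FX).
  exact: Lfun_measurable f2.
rewrite sqnorm_Rintegral// lee_fin gerBl.
rewrite -(Rintegral_mul_average hmu hX hX' hXX')//.
under eq_Rintegral do rewrite mulrC.
rewrite -Rintegral_averageM//; apply: Rintegral_ge0 => w _; exact: sqr_ge0.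
Qed.

Lemma L2_increment k F f : representative X mu F f ->
  (fun w => f (resample X X' k w) - f (X w)) \in Lfun P 2%:E.
Proof.
move=> Ff; apply: L2_B; last exact: representative_L2 Ff.
apply: (resample_L2 hmu hX hX' hXX'); last exact: representative_L2 Ff.
exact: representative_measurable Ff.
Qed.

(** [f(X^(k))] and [f(X)] have the same law, so that expanding the square gives
   [2 E[F^2] - 2 E[f(X^(k)) F]]. *)
Lemma Rintegral_increment_sqr k F f : L2X X F -> representative X mu F f ->
  \int[P]_w ((f (resample X X' k w) - f (X w)) *
             (f (resample X X' k w) - f (X w))) =
  2 * \int[P]_w (Dk X k F w * Dk X k F w).
Proof.
move=> FX Ff; rewrite (Rintegral_DkM k FX FX Ff Ff).
have mf := representative_measurable Ff; have f2 := representative_L2 Ff.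
have r2 := resample_L2 hmu hX hX' hXX' k mf f2.
under eq_Rintegral => w _.
  rewrite (_ : _ * _ = f (resample X X' k w) * f (resample X X' k w)
    + f (X w) * f (X w) - 2 * (f (X w) * f (resample X X' k w))); last by ring.
  over.
rewrite L1_RintegralB; [|by apply: L1_D; exact: L2_M|by apply: L1_Z; exact: L2_M].
rewrite L1_RintegralD; [|exact: L2_M..].
rewrite (Rintegral_resample hmu hX hX' hXX' k (f := fun x => f x * f x));
  last 2 first.
- exact: measurable_funM.
- exact: L2_M.
by rewrite L1_RintegralZ; [ring|exact: L2_M].
Qed.

End difference_operators.

(** * The closed gradient and its domain *)

Section series.
Context (R : realType).
Local Open Scope ereal_scope.

Lemma is_cvg_series_nneseries (u : nat -> R) : (forall k, 0 <= u k)%R ->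
  \sum_(0 <= k <oo) (u k)%:E < +oo -> cvgn (series u).
Proof.
move=> u0 su; apply: nondecreasing_is_cvgn.
  by apply: nondecreasing_series => k _ _; exact: u0.
exists (fine (\sum_(0 <= k <oo) (u k)%:E)) => _ [n _ <-].
have s0 : 0 <= \sum_(0 <= k <oo) (u k)%:E.
  by apply: nneseries_ge0 => k _ _; rewrite lee_fin.
rewrite -lee_fin fineK; last by rewrite ge0_fin_numE.
rewrite /series/= -sumEFin; apply: nneseries_lim_ge => k _ _.
by rewrite lee_fin.
Qed.

Lemma squeeze_cvge0 (u v : nat -> \bar R) : (forall n, 0 <= u n) ->
  (forall n, u n <= v n) -> v n @[n --> \oo] --> 0 -> u n @[n --> \oo] --> 0.
Proof.
move=> u0 uv v0; apply: (@squeeze_cvge _ _ _ _ (cst 0) _ v) => //.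
  by apply: nearW => n; rewrite u0 uv.
exact: cvg_cst.
Qed.

Lemma nneseries_head (c : \bar R) n : 0 <= c ->
  \sum_(0 <= k <oo) (if (k < n)%N then c else 0) = n%:R%:E * c.
Proof.
move=> c0; rewrite (nneseries_split 0 n) => [|k _]; last by case: ifP.
rewrite add0n [X in _ + X]eseries0 ?adde0; last first.
  by move=> k nk _; rewrite ltnNge nk.
rewrite (eq_big_nat _ _ (F2 := fun=> c)); last by move=> k /andP[_ ->].
by rewrite big_const_nat subn0 iter_addr addr0 mule_natl.
Qed.

End series.

Section gradient.
Context d (T : measurableType d) (R : realType) (P : probability T R).
Context (dE : nat -> measure_display) (E : forall n, measurableType (dE n)).
Context (muE : forall n, probability (E n) R) (mu : probability (seq_space E) R).
Hypothesis hmu : is_product_probability muE mu.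
Context (X X' : {RV P >-> seq_space E}).
Hypotheses (hX : has_distribution X mu) (hX' : has_distribution X' mu).
Hypothesis hXX' : independent_RV X X'.
Implicit Types (F G : T -> R) (H : nat -> T -> R).

Let L2X_Dk k F : L2X X F -> L2X X (Dk X k F).
Proof. exact: (L2X_Dk hmu hX hX' hXX'). Qed.
Let measurable_Dk k F : L2X X F -> measurable_fun setT (Dk X k F).
Proof. exact: (measurable_Dk hmu hX hX' hXX'). Qed.

Lemma sqnorm_le_seq H k : (sqnorm P (H k) <= seq_sqnorm P H)%E.
Proof.
have h n : (0 <= sqnorm P (H n))%E by exact: sqnorm_ge0.
apply: le_trans (nneseries_lim_ge k.+1 (fun n _ _ => h n)).
by rewrite big_nat_recr//= leeDr// sume_ge0.
Qed.

Lemma seq_L2X_L2 H k : seq_L2X X H -> H k \in Lfun P 2%:E.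
Proof.
move=> [mH sH]; apply/L2P; split; last exact: le_lt_trans (sqnorm_le_seq H k) sH.
exact: (measurable_wrt_measurable (@sigmaX_measurable _ _ _ _ _ _ X)).
Qed.

Lemma sqnormB_le F G K : F \in Lfun P 2%:E -> G \in Lfun P 2%:E ->
  K \in Lfun P 2%:E ->
  (sqnorm P (fun w => F w - G w)%R <= 2%:E * sqnorm P (fun w => F w - K w)%R +
     2%:E * sqnorm P (fun w => K w - G w)%R)%E.
Proof.
move=> F2 G2 K2.
have FG := L2_B F2 G2; have FK := L2_B F2 K2; have KG := L2_B K2 G2.
rewrite !sqnorm_Rintegral// -!EFinM -EFinD lee_fin.
have FK1 := L2_M FK FK; have KG1 := L2_M KG KG.
rewrite -(L1_RintegralZ 2 FK1) -(L1_RintegralZ 2 KG1).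
rewrite -L1_RintegralD; try exact: L1_Z.
apply: L1_le_Rintegral => [||w]; [exact: L2_M|by apply: L1_D; exact: L1_Z|].
by have := sqr_ge0 ((F w - K w) - (K w - G w)); nra.
Qed.

Lemma sqnormBC F G :
  sqnorm P (fun w => F w - G w) = sqnorm P (fun w => G w - F w).
Proof. by apply: eq_integral => w _; rewrite -sqrrN opprB. Qed.

(** Each [D_k] is continuous on L^2, so the closure cannot change it.  This is
   closability, and it describes [D] on its whole domain. *)
Lemma D_graph_Dk F H : D_graph X F H -> forall k, H k = Dk X k F %[ae P].
Proof.
move=> [FX HX [Fn [cF cvF cvD]]] k.
have FnX n : L2X X (Fn n) by case: (cF n).
have H2 := seq_L2X_L2 k HX; have D2 := L2X_L2 (L2X_Dk k FX).
suff /(sqnorm0_ae (L2_B H2 D2)) : sqnorm P (fun w => H k w - Dk X k F w) = 0%E.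
  apply: filterS => w e _; have := e I; rewrite /cst => /eqP.
  by rewrite subr_eq0 => /eqP.
apply/eqP; rewrite eq_le sqnorm_ge0 andbT.
pose v n := (2%:E * seq_sqnorm P (fun k => Dk X k (Fn n) \- H k)%R +
             2%:E * sqnorm P (Fn n \- F)%R)%E.
have v0 : v n @[n --> \oo] --> 0%E.
  rewrite [X in _ --> X](_ : 0%E = (2%:E * 0 + 2%:E * 0)%E :> \bar R).
    apply: cvgeD; first by rewrite mule0.
      exact: cvgeZl.
    exact: cvgeZl.
  by rewrite mule0 adde0.
have <- : limn v = 0%E by exact/cvg_lim.
apply: lime_ge; first by apply/cvg_ex; exists 0%E.
apply: nearW => n; have Dn2 := L2X_L2 (L2X_Dk k (FnX n)).
apply: le_trans (sqnormB_le H2 D2 Dn2) _.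
apply: leeD; apply: lee_wpmul2l => //.
  rewrite sqnormBC; exact: (sqnorm_le_seq (fun k => Dk X k (Fn n) \- H k) k).
have FnFX := L2X_B (FnX n) FX.
have <- : sqnorm P (Dk X k (fun w => Fn n w - F w)) =
    sqnorm P (fun w => Dk X k (Fn n) w - Dk X k F w).
  apply: sqnorm_ae; [exact: measurable_Dk| |exact: (DkB hmu hX hX' hXX')].
  by apply: measurable_funB; exact: measurable_Dk.
exact: (sqnorm_Dk_le hmu hX hX' hXX').
Qed.

Lemma dom_D_L2X F : dom_D X F -> L2X X F.
Proof. by move=> [H []]. Qed.

Lemma opD_Dk F : dom_D X F -> forall k, opD X F k = Dk X k F %[ae P].
Proof. by move=> FD; apply: D_graph_Dk; exact: (xgetPex (fun=> cst 0)). Qed.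

Lemma D_graph_energy F H : D_graph X F H ->
  seq_sqnorm P (fun k => Dk X k F) = seq_sqnorm P H.
Proof.
move=> FH; have [FX HX _] := FH; apply: eq_eseriesr => k _.
apply: sqnorm_ae; first exact: measurable_Dk.
  exact: Lfun_measurable (seq_L2X_L2 k HX).
exact/ae_eq_sym/(D_graph_Dk FH).
Qed.

Lemma dom_D_energy F : dom_D X F ->
  (seq_sqnorm P (fun k => Dk X k F) < +oo)%E.
Proof. by move=> [H FH]; rewrite (D_graph_energy FH); case: FH => _ []. Qed.

Lemma dom_D_series F : dom_D X F ->
  cvgn (series (fun k => \int[P]_w (Dk X k F w * Dk X k F w))).
Proof.
move=> FD; apply: is_cvg_series_nneseries => [k|].
  by apply: Rintegral_ge0 => w _; exact: sqr_ge0.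
have := dom_D_energy FD; rewrite /seq_sqnorm.
under eq_eseriesr do
  rewrite (sqnorm_Rintegral (L2X_L2 (L2X_Dk _ (dom_D_L2X FD)))).
by [].
Qed.

Lemma dom_D_seriesM F G : dom_D X F -> dom_D X G ->
  cvgn (series (fun k => \int[P]_w (Dk X k F w * Dk X k G w))).
Proof.
move=> FD GD; apply: normed_cvg.
have D2 K k : dom_D X K -> Dk X k K \in Lfun P 2%:E.
  by move=> /dom_D_L2X/(L2X_Dk k)/L2X_L2.
apply: (@series_le_cvg _ _ (fun k => \int[P]_w (Dk X k F w * Dk X k F w) +
   \int[P]_w (Dk X k G w * Dk X k G w))) => [k|k|k|].
- exact: normr_ge0.
- by apply: addr_ge0; apply: Rintegral_ge0 => w _; exact: sqr_ge0.
- apply: le_trans (le_normr_Rintegral _ _) _ => //.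
    by apply/Lfun1_integrable/L2_M; exact: D2.
  apply: le_trans (Rintegral_mul_le (D2 _ k FD) (D2 _ k GD)) _.
  by rewrite ler_piMl ?addr_ge0 ?invf_le1 ?ler1n//; apply: Rintegral_ge0 => w _;
    exact: sqr_ge0.
- exact: (is_cvg_seriesD (dom_D_series FD) (dom_D_series GD)).
Qed.

(** Duality between [D] and [delta].  The scalar product in
   L^2(kappa (x) P_F) is written as a convergent series, so that several of
   them can be combined term by term. *)
Lemma opL_duality F G : dom_L X F -> dom_D X G ->
  L2X X (opL X F) /\
  \sum_(0 <= k < n) (\int[P]_w (Dk X k G w * Dk X k F w)) @[n --> \oo] -->
    - \int[P]_w (G w * opL X F w).
Proof.
move=> [FD FdD] GD.
have [_ UX dual] : delta_graph X (opD X F) (opdelta X (opD X F)).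
  exact: (xgetPex (cst 0)).
have LX : L2X X (opL X F).
  have := L2X_B (L2X_cst X 0) UX; congr (L2X _ _).
  by apply/funext => w; rewrite sub0r.
split => //.
have HU := L2_M (L2X_L2 (dom_D_L2X GD)) (L2X_L2 LX).
have -> : - (\int[P]_w (G w * opL X F w)) = seq_inner P (opD X G) (opD X F).
  rewrite dual// -mulN1r -L1_RintegralZ//; apply: eq_Rintegral => w _.
  by rewrite /opL; ring.
have mD K k : dom_D X K -> measurable_fun setT (opD X K k).
  move=> KD; have : D_graph X K (opD X K) by exact: (xgetPex (fun=> cst 0)).
  by case=> _ KX _; exact: Lfun_measurable (seq_L2X_L2 k KX).
have e k : \int[P]_w (opD X G k w * opD X F k w) =
    \int[P]_w (Dk X k G w * Dk X k F w).
  apply: ae_eq_Rintegral; first by apply: measurable_funM; exact: mD.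
    by apply: measurable_funM; apply: measurable_Dk; exact: dom_D_L2X.
  by apply: filterS2 (opD_Dk GD k) (opD_Dk FD k) => w e1 e2 _; rewrite e1// e2.
rewrite /seq_inner.
under [X in _ --> limn X]eq_fun do under eq_bigr do rewrite e.
exact: (dom_D_seriesM GD FD).
Qed.

Lemma dom_D_cst c : dom_D X (cst c).
Proof.
have sqD0 k : sqnorm P (Dk X k (cst c)) = 0%E.
  rewrite (@sqnorm_ae _ _ _ P _ (cst 0) _ _ (Dk_cst X k c)) => [|//|//].
    by apply: integral0_eq => w _; rewrite expr0n.
  by apply: measurable_Dk; exact: L2X_cst.
exists (fun k => Dk X k (cst c)); split; first exact: L2X_cst.
  split=> [k|]; first by case: (L2X_Dk k (L2X_cst X c)).
  by rewrite /seq_sqnorm; under eq_eseriesr do rewrite sqD0; rewrite eseries0.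
exists (fun=> cst c); split.
- move=> n; split; first exact: L2X_cst.
  by exists 0%N; apply: measurable_wrt_cst; exact: sigma_algebra_coords.
- rewrite (_ : sqnorm P _ = 0%E); first exact: cvg_cst.
  by apply: integral0_eq => w _; rewrite /= subrr expr0n.
- rewrite (_ : seq_sqnorm P _ = 0%E); first exact: cvg_cst.
  apply: eseries0 => k _ _.
  by apply: integral0_eq => w _; rewrite /= subrr expr0n.
Qed.

Lemma sqnorm_indicM (A : set T) F : measurable A -> measurable_fun setT F ->
  (sqnorm P (fun w => \1_A w * F w)%R <= sqnorm P F)%E.
Proof.
move=> mA mF; apply: ge0_le_integral => //.
- by move=> w _; rewrite lee_fin sqr_ge0.
- exact/measurable_EFinP/measurable_funX/measurable_indicM.
- exact/measurable_EFinP/measurable_funX.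
- move=> w _; rewrite lee_fin indicE; case: (w \in A); rewrite ?mul1r//.
  by rewrite mul0r expr0n sqr_ge0.
Qed.

(** Only finitely many [D_k] see the indicator of an event that depends on
   finitely many coordinates. *)
Lemma energy_indicM n (A : set T) F :
  sigma_coords X [set j | (j < n)%N] A -> L2X X F ->
  (seq_sqnorm P (fun k => Dk X k (fun w => \1_A w * F w)%R) <=
   n%:R%:E * sqnorm P F + seq_sqnorm P (fun k => Dk X k F))%E.
Proof.
move=> sA FX; have XA := sigma_coords_sigmaX sA.
have mA := sigmaX_measurable XA; have AFX := L2X_indicM XA FX.
have mF := Lfun_measurable (L2X_L2 FX).
rewrite -nneseries_head ?sqnorm_ge0// -nneseriesD; last 2 first.
- by move=> k _ _; case: ifP => // _; exact: sqnorm_ge0.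
- by move=> k _ _; exact: sqnorm_ge0.
apply: lee_nneseries => [k _ _|k _]; first exact: sqnorm_ge0.
case: ltnP => kn.
  apply: le_trans (sqnorm_Dk_le hmu hX hX' hXX' k AFX) _.
  apply: le_trans (sqnorm_indicM mA mF) _.
  by rewrite leeDl// sqnorm_ge0.
rewrite add0e.
rewrite (sqnorm_ae _ _ (Dk_indicM hmu hX hX' hXX' kn sA FX)).
- by apply: sqnorm_indicM => //; exact: measurable_Dk.
- exact: measurable_Dk.
- by apply: measurable_indicM => //; exact: measurable_Dk.
Qed.

Lemma cylindrical_indicM n (A : set T) F :
  sigma_coords X [set j | (j < n)%N] A -> cylindrical X F ->
  cylindrical X (fun w => \1_A w * F w).
Proof.
move=> sA [FX [m mF]]; split.
  by apply: L2X_indicM => //; exact: sigma_coords_sigmaX sA.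
have sG := sigma_algebra_coords X [set j | (j < maxn n m)%N].
exists (maxn n m); apply: (measurable_wrtM sG).
  apply: (measurable_wrt_indic sG); apply: sigma_coords_sub sA => j /= jn.
  exact: leq_trans jn (leq_maxl _ _).
move=> B /mF; apply: sigma_coords_sub => j /= jn.
exact: leq_trans jn (leq_maxr _ _).
Qed.

(** If [F_m] are cylindrical approximations of [F], then so are [1_A F_m] for
   [1_A F]: the energy bound applies to [1_A (F_m - F)]. *)
Lemma dom_D_indicM n (A : set T) F :
  sigma_coords X [set j | (j < n)%N] A -> dom_D X F ->
  dom_D X (fun w => \1_A w * F w).
Proof.
move=> sA [H FH]; have [FX HX [Fn [cF cvF cvD]]] := FH.
have XA := sigma_coords_sigmaX sA; have mA := sigmaX_measurable XA.
have AFX := L2X_indicM XA FX.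
have FnX m : L2X X (Fn m) by case: (cF m).
exists (fun k => Dk X k (fun w => \1_A w * F w)); split => //.
  split=> [k|]; first by case: (L2X_Dk k AFX).
  apply: le_lt_trans (energy_indicM sA FX) _.
  apply: lte_add_pinfty; last by apply: dom_D_energy; exists H.
  by rewrite (sqnorm_Rintegral (L2X_L2 FX)) -EFinM ltry.
exists (fun m w => \1_A w * Fn m w); split.
- by move=> m; exact: cylindrical_indicM sA (cF m).
- apply: squeeze_cvge0 cvF => m; first exact: sqnorm_ge0.
  have := sqnorm_indicM mA (Lfun_measurable (L2X_L2 (L2X_B (FnX m) FX))).
  apply: le_trans; rewrite le_eqVlt; apply/orP; left; apply/eqP.
  by apply: eq_integral => w _ /=; rewrite mulrBr.
- pose v m := (n%:R%:E * sqnorm P (Fn m \- F)%R +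
     seq_sqnorm P (fun k => Dk X k (Fn m) \- H k)%R)%E.
  have v0 : v m @[m --> \oo] --> 0%E.
    rewrite [X in _ --> X](_ : 0%E = (n%:R%:E * 0 + 0)%E :> \bar R).
      by apply: cvgeD; [rewrite mule0|exact: cvgeZl|].
    by rewrite mule0 adde0.
  apply: squeeze_cvge0 v0 => m.
    by apply: nneseries_ge0 => k _ _; exact: sqnorm_ge0.
  have FnFX := L2X_B (FnX m) FX.
  have := energy_indicM sA FnFX.
  have -> : seq_sqnorm P (fun k => Dk X k (fun w => Fn m w - F w)) =
      seq_sqnorm P (fun k => Dk X k (Fn m) \- H k).
    apply: eq_eseriesr => k _; apply: sqnorm_ae; first exact: measurable_Dk.
      apply: measurable_funB; first exact: measurable_Dk.
      exact: Lfun_measurable (seq_L2X_L2 k HX).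
    apply: filterS2 (DkB hmu hX hX' hXX' k (FnX m) FX) (D_graph_Dk FH k).
    by move=> w e1 e2 _; rewrite e1// -e2.
  apply: le_trans; rewrite le_eqVlt; apply/orP; left; apply/eqP.
  have AFnX := L2X_indicM XA (FnX m).
  apply: eq_eseriesr => k _; apply: sqnorm_ae.
  + by apply: measurable_funB; exact: measurable_Dk.
  + by apply: measurable_Dk; exact: L2X_indicM.
  + have -> : (fun w => \1_A w * (Fn m w - F w)) =
        (fun w => \1_A w * Fn m w - \1_A w * F w).
      by apply/funext => w; rewrite mulrBr.
    have := DkB hmu hX hX' hXX' k AFnX AFX.
    by apply: filterS => w e _; rewrite e.
Qed.

End gradient.

(** * Series of integrable functions *)

(** Monotone convergence for the sum [M] of the absolute values, then dominated
   convergence with the bound [M]. *)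
Section L1_series.
Context d (T : measurableType d) (R : realType) (P : probability T R).
Context (u : nat -> T -> R).
Hypothesis u1 : forall k, u k \in Lfun P 1.
Hypothesis su : cvgn (series (fun k => \int[P]_w `|u k w|)).

Let mu_ k : measurable_fun setT (u k).
Proof. exact: Lfun_measurable (u1 k). Qed.

Let M w := (\sum_(0 <= k <oo) `|u k w|%:E)%E.

Let mM : measurable_fun setT M.
Proof.
apply: ge0_emeasurable_sum => [k w _ _|k _]; first by rewrite lee_fin.
by apply/measurable_EFinP; exact: measurableT_comp.
Qed.

Let M0 w : (0 <= M w)%E.
Proof. by apply: nneseries_ge0 => k _ _; rewrite lee_fin. Qed.

Let iM : P.-integrable setT M.
Proof.
apply/integrableP; split => //.
under eq_integral do rewrite gee0_abs//.
rewrite /M integral_nneseries//; last first.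
  by move=> k; apply/measurable_EFinP; exact: measurableT_comp.
have e k : (\int[P]_w `|u k w|%:E)%E = (\int[P]_w `|u k w|)%:E.
  rewrite /Rintegral fineK//; apply: integrable_fin_num => //.
  by have := L1_norm (u1 k); rewrite Lfun1_integrable.
under eq_eseriesr do rewrite e.
rewrite (_ : (\sum_(0 <= k <oo) _)%E =
  (limn (series (fun k => \int[P]_w `|u k w|)))%:E) ?ltry//.
rewrite -EFin_lim//; congr (limn _); apply/funext => n.
by rewrite /= /series/= sumEFin.
Qed.

Lemma L1_series_cvg : {ae P, forall w, cvgn (series (u ^~ w))}.
Proof.
have := integrable_ae measurableT iM; apply: filterS => w /(_ I) Mw.
apply: normed_cvg; apply: is_cvg_series_nneseries => [k|]; first exact: normr_ge0.
by move: Mw; rewrite ge0_fin_numE.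
Qed.

Let s w := limn (series (u ^~ w)).

Let mseries n : measurable_fun setT (fun w => series (u ^~ w) n).
Proof. by apply: measurable_sum. Qed.

Let ms : measurable_fun setT s.
Proof. exact: measurable_fun_limn. Qed.

Lemma L1_series_indicM (A : set T) : measurable A ->
  (fun w => \1_A w * s w) \in Lfun P 1 /\
  \sum_(0 <= k < n) \int[P]_w (\1_A w * u k w) @[n --> \oo] -->
    \int[P]_w (\1_A w * s w).
Proof.
move=> mA.
pose f_ n w := (\1_A w * series (u ^~ w) n)%:E.
have [|||||i _ c] := @dominated_convergence _ T R P setT measurableT f_
  (fun w => (\1_A w * s w)%:E) M.
- by move=> n; exact/measurable_EFinP/measurable_indicM.
- exact/measurable_EFinP/measurable_indicM.
- have := L1_series_cvg; apply: filterS => w cw _.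
  apply: cvg_EFin; first exact: nearW.
  by apply: cvgMr; exact: cw.
- exact: iM.
- apply: aeW => w n _; rewrite /f_ abse_EFin.
  apply: le_trans (_ : (`|series (u ^~ w) n|%:E <= _)%E).
    by rewrite lee_fin; exact: (normr_indicM A (fun w => series (u ^~ w) n)).
  apply: (@le_trans _ _ (\sum_(0 <= k < n) `|u k w|%:E)%E).
    by rewrite sumEFin lee_fin; exact: ler_norm_sum.
  by apply: nneseries_lim_ge => k _ _; rewrite lee_fin.
split; first by rewrite Lfun1_integrable.
have e n : (\int[P]_w f_ n w)%E =
    (\sum_(0 <= k < n) \int[P]_w (\1_A w * u k w))%:E.
  rewrite /f_ -sumEFin.
  under eq_integral do rewrite /series/= big_distrr/= -sumEFin.
  rewrite integral_sum//; last first.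
    by move=> k; have := L1_indicM mA (u1 k); rewrite Lfun1_integrable.
  apply: eq_bigr => k _; rewrite /Rintegral fineK//.
  apply: integrable_fin_num => //.
  by have := L1_indicM mA (u1 k); rewrite Lfun1_integrable.
have l : (\int[P]_w (\1_A w * s w)%:E)%E = (\int[P]_w (\1_A w * s w))%:E.
  by rewrite /Rintegral fineK//; exact: integrable_fin_num.
move: c; rewrite l => /fine_cvgP[_ h].
rewrite [X in X @ _](_ : _ = fine \o (fun n => \int[P]_w f_ n w)%E)//.
by apply/funext => n; rewrite /= e.
Qed.

End L1_series.

(** * Comparison of the two carre-du-champ operators *)

Section carre_du_champ.
Context d (T : measurableType d) (R : realType) (P : probability T R).
Context (dE : nat -> measure_display) (E : forall n, measurableType (dE n)).
Context (muE : forall n, probability (E n) R) (mu : probability (seq_space E) R).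
Hypothesis hmu : is_product_probability muE mu.
Context (X X' : {RV P >-> seq_space E}).
Hypotheses (hX : has_distribution X mu) (hX' : has_distribution X' mu).
Hypothesis hXX' : independent_RV X X'.
Local Notation S := (seq_space E).
Implicit Types (F G : T -> R) (f g : S -> R).

(** Cylinders form a pi-system that generates the product sigma-algebra, and
   the events over which an integral vanishes form a lambda-system. *)
Lemma integral_cylinder_eq0 (V : T -> R) : V \in Lfun P 1 ->
  (forall n (A : forall i, set (E i)), (forall i, measurable (A i)) ->
    (\int[P]_(w in X @^-1` cylinder n A) (V w)%:E = 0)%E) ->
  forall A, sigmaX X A -> (\int[P]_(w in A) (V w)%:E = 0)%E.
Proof.
move=> V1 V0 _ [B mB <-]; rewrite setTI.
have iV := (Lfun1_integrable P V).1 V1.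
have mXB C : measurable C -> measurable (X @^-1` C).
  by move=> mC; rewrite -[X in measurable X]setTI; exact: measurable_funP.
have V0T : (\int[P]_w (V w)%:E = 0)%E.
  have := V0 0%N (fun=> setT) (fun=> measurableT).
  by rewrite (_ : X @^-1` _ = setT)//; apply/seteqP.
move: B mB; rewrite measurable_cylinders.
apply: (dynkin_induction (@measurable_cylinders _ E) (@cylinders_setI _ E)).
- by rewrite preimage_setT.
- by move=> _ [n [A [mA ->]]]; exact: V0.
- move=> C mC VC; have mXC := mXB _ mC.
  have : (\int[P]_(w in X @^-1` C `|` X @^-1` (~` C)) (V w)%:E = 0)%E.
    by rewrite -preimage_setU setUv preimage_setT.
  rewrite integral_setU//.
  + by rewrite VC add0e.
  + exact/mXB/measurableC.
  + rewrite -preimage_setU setUv preimage_setT.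
    exact/measurable_EFinP/(Lfun_measurable V1).
  + by rewrite disj_set2E -preimage_setI setICr preimage_set0.
- move=> C mC tC VC; rewrite preimage_bigcup integral_bigcup//.
  + by rewrite eseries0.
  + apply/trivIsetP => i j _ _ ij; rewrite -preimage_setI.
    by have /trivIsetP -> := tC; rewrite ?preimage_set0.
  + by move=> k; exact: mXB.
  + apply: integrableS iV => //; apply: bigcup_measurable => k _; exact: mXB.
Qed.

Lemma representativeM F G f g : L2X X (F \* G) ->
  representative X mu F f -> representative X mu G g ->
  representative X mu (F \* G) (fun x => f x * g x).
Proof.
move=> FGX Ff Gg.
have mf := representative_measurable Ff; have mg := representative_measurable Gg.
have e : F \* G = (fun x => f x * g x) \o X %[ae P].
  case: Ff Gg => _ e1 [_ e2]; apply: filterS2 e1 e2 => w e1 e2 _.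
  by rewrite /= e1// e2.
have mfg : measurable_fun setT (fun x => f x * g x) by exact: measurable_funM.
split=> //; apply/(law_L2 hX mfg); apply: (L2_ae _ e); last exact: L2X_L2 FGX.
by apply: measurableT_comp => //; exact: measurable_funP.
Qed.

Lemma representative_indicM (B : set S) F f : measurable B ->
  representative X mu F f ->
  representative X mu (fun w => \1_(X @^-1` B) w * F w)
    (fun x => \1_B x * f x).
Proof.
move=> mB [f2 e]; split; first exact: L2_indicM.
by apply: filterS e => w e _; rewrite /= e.
Qed.

Lemma increment_L1 k F G f g :
  representative X mu F f -> representative X mu G g ->
  Gamma0_increment X X' f g k \in Lfun P 1.
Proof.
move=> Ff Gg; apply: L2_M; first exact: (L2_increment hmu hX hX' hXX' k Ff).
exact: (L2_increment hmu hX hX' hXX' k Gg).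
Qed.

Lemma is_condexp_Gamma0_term k F G f g :
  representative X mu F f -> representative X mu G g ->
  is_condexp P (sigmaX X) (Gamma0_increment X X' f g k) (Gamma0_term X X' f g k).
Proof.
move=> Ff Gg.
have mf := representative_measurable Ff; have mg := representative_measurable Gg.
pose h (z : S * S) := (f (replace k z) - f z.1) * (g (replace k z) - g z.1).
have mh : measurable_fun setT h.
  by apply: measurable_funM; apply: measurable_funB;
    [exact: measurableT_comp (measurable_replace k)|exact: measurableT_comp
    |exact: measurableT_comp (measurable_replace k)|exact: measurableT_comp].
apply: is_condexp_condexp.
exact: (is_condexp_integrate_snd hX hX' hXX' mh (increment_L1 k Ff Gg)).
Qed.

(** The algebraic core.  Expressed by representatives, the three energies on
   the right-hand side consist of the terms [h f g (X)], which occur with total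
   sign [+], and of the expectations of [h(X) f(X) g(X^(k))],
   [h(X) g(X) f(X^(k))] and [h(X) f g (X^(k))]: together, the expansion of
   [h(X) Delta_k f Delta_k g], with [h] the indicator of [A]. *)
Lemma Rintegral_indicM_increment k A F G f g : sigmaX X A ->
  L2X X F -> L2X X G -> L2X X (F \* G) ->
  representative X mu F f -> representative X mu G g ->
  \int[P]_w (\1_A w * Gamma0_increment X X' f g k w) =
  \int[P]_w (Dk X k (fun w => \1_A w * G w) w * Dk X k F w)
  + \int[P]_w (Dk X k (fun w => \1_A w * F w) w * Dk X k G w)
  - \int[P]_w (Dk X k (fun w => \1_A w * cst 1 w) w * Dk X k (F \* G) w).
Proof.
move=> XA FX GX FGX Ff Gg; have mA := sigmaX_measurable XA.
have AFX := L2X_indicM XA FX; have AGX := L2X_indicM XA GX.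
have A1X := L2X_indicM XA (L2X_cst X 1).
case: XA A1X AFX AGX mA => B mB; rewrite setTI => <- A1X AFX AGX mA.
have c1 : representative X mu (cst 1) (cst 1).
  by split; [exact: Lfun_cst|exact: aeW].
have FGfg := representativeM FGX Ff Gg.
have AFf := representative_indicM mB Ff; have AGg := representative_indicM mB Gg.
have A1 := representative_indicM mB c1.
have Dcomm (U V : T -> R) : \int[P]_w (Dk X k U w * Dk X k V w) =
    \int[P]_w (Dk X k V w * Dk X k U w).
  by apply: eq_Rintegral => w _; rewrite mulrC.
rewrite 3!(Dcomm (fun w => _ * _)).
rewrite (Rintegral_DkM hmu hX hX' hXX' k FX AGX Ff AGg).
rewrite (Rintegral_DkM hmu hX hX' hXX' k GX AFX Gg AFf).
rewrite (Rintegral_DkM hmu hX hX' hXX' k FGX A1X FGfg A1).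
have mf := representative_measurable Ff; have mg := representative_measurable Gg.
have f2 := representative_L2 hX Ff; have g2 := representative_L2 hX Gg.
have fg2 := representative_L2 hX FGfg.
have rf := resample_L2 hmu hX hX' hXX' k mf f2.
have rg := resample_L2 hmu hX hX' hXX' k mg g2.
have rfg := resample_L2 hmu hX hX' hXX' k (representative_measurable FGfg) fg2.
have a2 := L2_indic P mA.
have af := representative_L2 hX AFf; have ag := representative_L2 hX AGg.
have a1 := representative_L2 hX A1.
rewrite -!L1_RintegralB; try exact: L2_M.
rewrite -L1_RintegralD; try by apply: L1_B; exact: L2_M.
rewrite -L1_RintegralB; last 2 first.
- by apply: L1_D; apply: L1_B; exact: L2_M.
- by apply: L1_B; exact: L2_M.
apply: eq_Rintegral => w _; rewrite /Gamma0_increment/= /cst.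
rewrite (_ : \1_(X @^-1` B) w = \1_B (X w))//.
by ring.
Qed.

Lemma Rintegral_increment_le k F G f g : L2X X F -> L2X X G ->
  representative X mu F f -> representative X mu G g ->
  \int[P]_w `|Gamma0_increment X X' f g k w| <=
  \int[P]_w (Dk X k F w * Dk X k F w) + \int[P]_w (Dk X k G w * Dk X k G w).
Proof.
move=> FX GX Ff Gg.
have := Rintegral_mul_le (L2_increment hmu hX hX' hXX' k Ff)
  (L2_increment hmu hX hX' hXX' k Gg).
rewrite (Rintegral_increment_sqr hmu hX hX' hXX' k FX Ff).
rewrite (Rintegral_increment_sqr hmu hX hX' hXX' k GX Gg).
by rewrite -mulrDr mulrA mulVf// mul1r.
Qed.

(** Summability of the terms of [Gamma_0], from the finiteness of the energies
   of [F] and [G]. *)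
Lemma Gamma0_term_series F G f g : dom_D X F -> dom_D X G ->
  representative X mu F f -> representative X mu G g ->
  cvgn (series (fun k => \int[P]_w `|Gamma0_term X X' f g k w|)).
Proof.
move=> FD GD Ff Gg.
apply: (@series_le_cvg _ _ (fun k => \int[P]_w (Dk X k F w * Dk X k F w) +
   \int[P]_w (Dk X k G w * Dk X k G w))) => [k|k|k|].
- by apply: Rintegral_ge0 => w _; exact: normr_ge0.
- by apply: addr_ge0; apply: Rintegral_ge0 => w _; exact: sqr_ge0.
- apply: le_trans (Rintegral_increment_le k (dom_D_L2X FD) (dom_D_L2X GD) Ff Gg).
  apply: (is_condexp_norm_le (sigma_algebra_sigmaX X)
    (@sigmaX_measurable _ _ _ _ _ _ X)).
    exact: increment_L1 Ff Gg.
  exact: is_condexp_Gamma0_term Ff Gg.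
- exact: (is_cvg_seriesD (dom_D_series hmu hX hX' hXX' FD)
    (dom_D_series hmu hX hX' hXX' GD)).
Qed.

Lemma L2X_opL F : dom_L X F -> L2X X (opL X F).
Proof.
move=> FL; have [FD _] := FL.
by have [] := opL_duality hmu hX hX' hXX' FL FD.
Qed.

Lemma Gamma_L1 F G : dom_L X F -> dom_L X G -> dom_L X (F \* G) ->
  Gamma X F G \in Lfun P 1.
Proof.
move=> FL GL FGL.
have FX := L2X_L2 (dom_D_L2X FL.1); have GX := L2X_L2 (dom_D_L2X GL.1).
apply: L1_Z; apply: L1_B; last exact: L2_M (L2X_L2 (L2X_opL GL)).
apply: L1_B; last exact: L2_M (L2X_L2 (L2X_opL FL)).
exact: L2_L1 (L2X_L2 (L2X_opL FGL)).
Qed.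

Lemma measurable_wrt_Gamma F G : dom_L X F -> dom_L X G -> dom_L X (F \* G) ->
  measurable_wrt (sigmaX X) (Gamma X F G).
Proof.
move=> FL GL FGL; have sX := sigma_algebra_sigmaX X.
have [mF _] := dom_D_L2X FL.1; have [mG _] := dom_D_L2X GL.1.
have [mLF _] := L2X_opL FL; have [mLG _] := L2X_opL GL.
have [mLFG _] := L2X_opL FGL.
apply: (measurable_wrtZ sX); apply: (measurable_wrtB sX).
  by apply: (measurable_wrtB sX) => //; exact: (measurable_wrtM sX).
exact: (measurable_wrtM sX).
Qed.

(** Summing the previous identity over [k] requires [1_A], [1_A F] and [1_A G]
   to be in the domain of [D]: this is where [A] has to depend on finitely many
   coordinates. *)
Lemma Rintegral_indicM_increment_cvg n A F G f g :
  sigma_coords X [set j | (j < n)%N] A ->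
  dom_L X F -> dom_L X G -> dom_L X (F \* G) ->
  representative X mu F f -> representative X mu G g ->
  \sum_(0 <= k < m) \int[P]_w (\1_A w * Gamma0_increment X X' f g k w)
    @[m --> \oo] --> 2 * \int[P]_w (\1_A w * Gamma X F G w).
Proof.
move=> sA FL GL FGL Ff Gg.
have XA := sigma_coords_sigmaX sA; have mA := sigmaX_measurable XA.
have AD K : dom_D X K -> dom_D X (fun w => \1_A w * K w).
  exact: (dom_D_indicM hmu hX hX' hXX' sA).
have [_ c1] := opL_duality hmu hX hX' hXX' FL (AD _ GL.1).
have [_ c2] := opL_duality hmu hX hX' hXX' GL (AD _ FL.1).
have [_ c3] := opL_duality hmu hX hX' hXX' FGL
  (AD _ (dom_D_cst hmu hX hX' hXX' 1)).
have := cvgB (cvgD c1 c2) c3.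
have F2 := L2X_L2 (dom_D_L2X FL.1); have G2 := L2X_L2 (dom_D_L2X GL.1).
have LF2 := L2X_L2 (L2X_opL FL); have LG2 := L2X_L2 (L2X_opL GL).
have LFG2 := L2X_L2 (L2X_opL FGL).
have c : (cst 1 : T -> R) \in Lfun P 2%:E by exact: Lfun_cst.
have AF := L2_indicM mA F2; have AG := L2_indicM mA G2.
have A1 := L2_indicM mA c.
rewrite (_ : - _ + _ - _ = 2 * \int[P]_w (\1_A w * Gamma X F G w)); last first.
  rewrite -L1_RintegralZ; last by apply: L1_indicM => //; exact: Gamma_L1.
  rewrite -opprD opprK -L1_RintegralD; try exact: L2_M.
  rewrite addrC -L1_RintegralB; [|exact: L2_M|by apply: L1_D; exact: L2_M].
  have e (a x y z u v : R) : a * 1 * x - (a * u * y + a * v * z) =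
      2 * (a * (2^-1 * (x - u * y - v * z))) by field.
  by apply: eq_Rintegral => w _; exact: e.
rewrite [X in X @ _ --> _](_ : _ = (fun m => \sum_(0 <= k < m)
  \int[P]_w (\1_A w * Gamma0_increment X X' f g k w))); first by apply.
apply/funext => m; rewrite !fctE -big_split/= -sumrN -big_split/=.
apply: eq_bigr => k _; apply/esym.
by apply: Rintegral_indicM_increment => //; apply: dom_D_L2X;
  [case: FL|case: GL|case: FGL].
Qed.

End carre_du_champ.

Theorem proposition2p11 (R : realType)
    (dE : nat -> measure_display) (E : forall n, measurableType (dE n))
    (muE : forall n, probability (E n) R)
    (mu : probability (seq_space E) R)
    (hmu : is_product_probability muE mu)
    (d : measure_display) (T : measurableType d) (P : probability T R)
    (X X' : {RV P >-> seq_space E})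
    (hX : has_distribution X mu) (hX' : has_distribution X' mu)
    (hXX' : independent_RV X X')
    (F G : T -> R)
    (hF : dom_L X F) (hG : dom_L X G) (hFG : dom_L X (F \* G)) :
  (exists f, representative X mu F f) /\
  (exists g, representative X mu G g) /\
  forall f g : seq_space E -> R,
    representative X mu F f -> representative X mu G g ->
    [/\ forall k, Gamma0_increment X X' f g k \in Lfun P 1,
        {ae P, forall w,
          cvgn (fun n => \sum_(0 <= k < n) Gamma0_term X X' f g k w)},
        Gamma0 X X' f g \in Lfun P 1 &
        Gamma X F G = Gamma0 X X' f g %[ae P]].
Proof.
have FD := hF.1; have GD := hG.1.
split; first exact: (L2X_representative hX (dom_D_L2X FD)).
split; first exact: (L2X_representative hX (dom_D_L2X GD)).
move=> f g Ff Gg.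
have sX := sigma_algebra_sigmaX X.
have XT := @sigmaX_measurable _ _ _ P _ _ X.
have inc1 k := increment_L1 hmu hX hX' hXX' k Ff Gg.
have ce k := is_condexp_Gamma0_term hmu hX hX' hXX' k Ff Gg.
have term1 k : Gamma0_term X X' f g k \in Lfun P 1 by case: (ce k).
have su := Gamma0_term_series hmu hX hX' hXX' FD GD Ff Gg.
have Gamma0_1 : Gamma0 X X' f g \in Lfun P 1.
  apply: L1_Z; have [+ _] := L1_series_indicM term1 su measurableT.
  by under eq_fun do rewrite indicT mul1r.
have Gamma1 := Gamma_L1 hmu hX hX' hXX' hF hG hFG.
split => //; first exact: (L1_series_cvg term1 su).
have Gamma0X : measurable_wrt (sigmaX X) (Gamma0 X X' f g).
  apply: (measurable_wrtZ sX); apply: (measurable_wrt_limn sX) => n.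
  by apply: (measurable_wrt_sum sX) => k; case: (ce k).
have cyl A n : sigma_coords X [set j | (j < n)%N] A ->
    \int[P]_w (\1_A w * Gamma X F G w) =
    \int[P]_w (\1_A w * Gamma0 X X' f g w).
  move=> sA; have XA := sigma_coords_sigmaX sA; have mA := XT _ XA.
  have c1 := Rintegral_indicM_increment_cvg hmu hX hX' hXX' sA hF hG hFG Ff Gg.
  have [s1 c2] := L1_series_indicM term1 su mA.
  have e k : \int[P]_w (\1_A w * Gamma0_increment X X' f g k w) =
      \int[P]_w (\1_A w * Gamma0_term X X' f g k w).
    by have [_ _ ->] := (is_condexpP XT _ (inc1 k)).1 (ce k).
  rewrite (eq_fun (fun m => eq_bigr _ (fun k _ => e k))) in c1.
  have {c1 c2} e2 := cvg_unique (@Rhausdorff R) c1 c2.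
  apply: (mulfI (_ : 2 != 0 :> R)) => //; rewrite e2 -L1_RintegralZ.
    by apply: eq_Rintegral => w _; rewrite /Gamma0 mulrCA mulVKf.
  exact: L1_indicM.
have diff0 A : sigmaX X A ->
    (\int[P]_(w in A) (Gamma X F G w - Gamma0 X X' f g w)%:E = 0)%E.
  apply: (integral_cylinder_eq0
    (V := fun w => Gamma X F G w - Gamma0 X X' f g w)).
    exact: L1_B.
  move=> n B mB.
  have sB : sigma_coords X [set j | (j < n)%N] (X @^-1` cylinder n B).
    exact: sigma_coords_cylinder.
  have mXB := XT _ (sigma_coords_sigmaX sB).
  rewrite integral_indicM//; last exact: L1_B.
  congr EFin; under eq_Rintegral do rewrite mulrBr.
  by rewrite L1_RintegralB ?(cyl _ _ sB) ?subrr//; exact: L1_indicM.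
(* both sides are versions of the conditional expectation of Gamma0 given X *)
apply: (condexp_unique sX XT Gamma0_1); last by split.
apply/(is_condexpP XT _ Gamma0_1); split => //.
  exact: (measurable_wrt_Gamma hmu hX hX' hXX' hF hG hFG).
move=> A XA; have mA := XT _ XA.
have := diff0 A XA; rewrite integral_indicM//; last exact: L1_B.
under eq_Rintegral do rewrite mulrBr.
by rewrite L1_RintegralB;
  [move=> [/eqP]; rewrite subr_eq0 => /eqP|exact: L1_indicM..].
Qed.
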